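(* Let $R$ be an artin algebra, $\mathcal{A}=\mathrm{mod}(R)$, and let $\mathcal{C}\subseteq\mathcal{A}$ be a full additive, strictly full, Karoubi closed subcategory which is $\mathcal{A}$-approximating. Let $C\in\mathcal{C}$ be indecomposable, and let $\mathfrak{m}$ be the maximal ideal of the local artinian ring $\mathrm{End}_{\mathcal{H}_{\mathcal{C}}}(\mathsf{P}_C)=\mathrm{End}_{\mathcal{C}}(C)$. Let $\tau\in\mathrm{Hom}_{\mathcal{H}_{\mathcal{C}}}(\mathsf{P}_C,\mathbb{S}_{\mathcal{C}}\mathsf{P}_C)$ be non-zero such that $\tau\circ\mathfrak{m}=0$. Then $\mathsf{L}_C\cong\mathrm{Im}\,\tau$ (image in $\mathcal{H}_{\mathcal{C}}$). (The uniqueness of $\mathsf{L}_C$ implies that such a $\tau$ is unique up to a scalar.)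
   Context: $R$ is finite over its center $k$, a commutative artinian ring; $\mathrm{mod}(R)$ is the category of finitely generated left $R$-modules; $\mathbb{D}=\mathrm{Hom}_k(-,E)$ with $E$ the injective hull of $k/\mathrm{rad}(k)$ as $k$-module. Strictly full means closed under isomorphisms; Karoubi closed means closed under direct summands in $\mathcal{A}$. $\mathcal{T}_{\mathcal{C}}=K^-(\mathcal{C})$ (bounded above cochain complexes modulo homotopy) is a full triangulated subcategory of $\mathcal{T}_{\mathcal{A}}=K^-(\mathcal{A})$. A $\mathcal{C}$-approximation of $X\in\mathcal{T}_{\mathcal{A}}$ is a quasi-isomorphism $X_{\mathcal{C}}\to X$ with $X_{\mathcal{C}}\in\mathcal{T}_{\mathcal{C}}$ inducing an isomorphism $\mathrm{Hom}_{\mathcal{T}_{\mathcal{C}}}(-,X_{\mathcal{C}})\to\mathrm{Hom}_{\mathcal{T}_{\mathcal{A}}}(-,X)|_{\mathcal{T}_{\mathcal{C}}}$. $\mathcal{C}$ is $\mathcal{A}$-approximating if every $X\in\mathcal{T}_{\mathcal{A}}$ has a $\mathcal{C}$-approximation; then $\pi_{\mathcal{C}}X=X_{\mathcal{C}}$ defines a functor $\pi_{\mathcal{C}}:\mathcal{T}_{\mathcal{A}}\to\mathcal{T}_{\mathcal{C}}$ right adjoint to the inclusion. $\mathcal{H}_{\mathcal{A}}$ is the abelian category of complexes $[X^{-2}\to X^{-1}\to X^0]$ in $\mathcal{A}$ with no cohomology in negative degrees, morphisms modulo homotopy. $\mathcal{T}^{\leq 0}_{\mathcal{C}}$ is the strictly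 full subcategory of $\mathcal{T}_{\mathcal{C}}$ generated by complexes with $X^i=0$ for $i>0$; it is the $\leq 0$ part of a $t$-structure with $\mathcal{T}^{\geq 0}_{\mathcal{C}}=\{X\mid\mathrm{Hom}_{\mathcal{T}_{\mathcal{C}}}(\mathcal{T}^{\leq 0}_{\mathcal{C}}[1],X)=0\}$, and $\mathcal{H}_{\mathcal{C}}$ is its heart, an abelian category; $\pi_{\mathcal{C}}(\mathcal{H}_{\mathcal{A}})=\mathcal{H}_{\mathcal{C}}$. $\mathsf{P}_M$ is the complex with $M$ in degree $0$; $M\mapsto\mathsf{P}_M$ gives equivalences $\mathcal{A}\cong\mathrm{Proj}(\mathcal{H}_{\mathcal{A}})$ and $\mathcal{C}\cong\mathrm{Proj}(\mathcal{H}_{\mathcal{C}})$. For $M\in\mathcal{C}$ indecomposable, $\mathsf{L}_M$ is the unique (up to isomorphism) simple quotient of $\mathsf{P}_M$ in $\mathcal{H}_{\mathcal{C}}$. For $M\in\mathcal{A}$, $\mathbb{S}_{\mathcal{A}}\mathsf{P}_M$ is the unique injective object of $\mathcal{H}_{\mathcal{A}}$ with $\mathbb{D}\,\mathrm{Hom}_{\mathcal{H}_{\mathcal{A}}}(\mathsf{P}_M,-)\cong\mathrm{Hom}_{\mathcal{H}_{\mathcal{A}}}(-,\mathbb{S}_{\mathcal{A}}\mathsf{P}_M)$, and $\mathbb{S}_{\mathcal{C}}\mathsf{P}_M:=\pi_{\mathcal{C}}(\mathbb{S}_{\mathcal{A}}\mathsf{P}_M)$ for $M\in\mathcal{C}$.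 *)

(* Defs.v *)
From HB Require Import structures.
From mathcomp Require Import all_boot all_order all_algebra.

Set Implicit Arguments.
Unset Strict Implicit.
Unset Printing Implicit Defensive.

Import Order.TTheory GRing.Theory Num.Theory.
Local Open Scope ring_scope.

Definition is_zero_module (K : pzRingType) (M : lmodType K) : Prop :=
  forall x : M, x = 0.

Definition finitely_generated (K : pzRingType) (M : lmodType K) : Prop :=
  exists (n : nat) (g : 'I_n -> M),
    forall x : M, exists c : 'I_n -> K, x = \sum_(i < n) c i *: g i.

Definition isomorphic_modules (K : pzRingType) (M N : lmodType K) : Prop :=
  exists f : {linear M -> N}, bijective f.

Definition indecomposable (K : pzRingType) (M : lmodType K) : Prop :=
  ~ is_zero_module M /\
  forall M1 M2 : lmodType K, isomorphic_modules M (M1 * M2)%type ->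
    is_zero_module M1 \/ is_zero_module M2.

Definition submodule (K : pzRingType) (M : lmodType K) (N : M -> Prop) : Prop :=
  [/\ N 0, (forall x y, N x -> N y -> N (x + y)) &
      (forall a x, N x -> N (a *: x))].

Definition injective_module (K : pzRingType) (E : lmodType K) : Prop :=
  forall (A B : lmodType K) (i : {linear A -> B}) (f : {linear A -> E}),
    injective i -> exists g : {linear B -> E}, forall a : A, g (i a) = f a.

Definition ideal (k : comPzRingType) (I : k -> Prop) : Prop :=
  @submodule k k^o I.

Definition artinian (k : comPzRingType) : Prop :=
  forall I : nat -> k -> Prop,
    (forall n, ideal (I n)) -> (forall n a, I n.+1 a -> I n a) ->
    exists n, forall m, (n <= m)%N -> forall a, I n a -> I m a.

Definition maximal_ideal (k : comPzRingType) (I : k -> Prop) : Prop :=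
  [/\ ideal I, ~ I 1 &
      forall J : k -> Prop, ideal J -> ~ J 1 ->
        (forall a, I a -> J a) -> forall a, J a -> I a].

Definition radical (k : comPzRingType) (a : k) : Prop :=
  forall I : k -> Prop, maximal_ideal I -> I a.

(* E is an injective hull of k / rad k.  The essential monomorphism
   k / rad k -> E is given as a linear map k -> E with kernel rad k. *)
Definition injective_hull_residue (k : comPzRingType) (E : lmodType k) : Prop :=
  injective_module E /\
  exists j : {linear k^o -> E},
    (forall a : k, j a = 0 <-> radical a) /\
    (forall N : E -> Prop, submodule N -> (exists2 e, N e & e <> 0) ->
       exists2 a : k, N (j a) & j a <> 0).

(* R is an artin algebra whose center is k, the inclusion of the center being
   a |-> a%:A. *)
Definition artin_algebra (k : comPzRingType) (R : algType k) : Prop :=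
  [/\ injective (fun a : k => a%:A : R),
      (forall z : R, (forall x : R, z * x = x * z) -> exists a : k, z = a%:A),
      artinian k & @finitely_generated k R].

(* The degree n homotopy h^n : X^n -> Y^(n-1) and all (co)cycle conditions in
   degree n are indexed by n = i + 1, so that no type casts are needed. *)
Record complex (R : pzRingType) := Complex {
  cterm :> int -> lmodType R;
  cdiff : forall i : int, {linear cterm i -> cterm (i + 1)};
  cdiffK : forall (i : int) (x : cterm i), cdiff (i + 1) (cdiff i x) = 0
}.
Arguments cdiff {R} X i : rename.

Record chmap (R : pzRingType) (X Y : complex R) := ChMap {
  cmap :> forall i : int, {linear X i -> Y i};
  cmapE : forall (i : int) (x : X i),
    cmap (i + 1) (cdiff X i x) = cdiff Y i (cmap i x)
}.

Section Complexes.
Variable R : pzRingType.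
Implicit Types X Y Z : complex R.

Definition homotopic X Y (f g : chmap X Y) : Prop :=
  exists h : forall i : int, {linear X (i + 1) -> Y i},
    forall (i : int) (x : X (i + 1)),
      f (i + 1) x - g (i + 1) x
        = cdiff Y i (h i x) + h (i + 1) (cdiff X (i + 1) x).

Fact chid_subproof X (i : int) (x : X i) :
  idfun (cdiff X i x) = cdiff X i (idfun x).
Proof. by []. Qed.

Definition chid X : chmap X X :=
  @ChMap R X X (fun i => idfun) (@chid_subproof X).

Fact chzero_subproof X Y (i : int) (x : X i) :
  (\0 : {linear X (i + 1) -> Y (i + 1)}) (cdiff X i x)
    = cdiff Y i ((\0 : {linear X i -> Y i}) x).
Proof. by rewrite /= linear0. Qed.

Definition chzero X Y : chmap X Y :=
  @ChMap R X Y (fun i => \0) (@chzero_subproof X Y).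

Fact chcomp_subproof X Y Z (g : chmap Y Z) (f : chmap X Y) (i : int) (x : X i) :
  (g (i + 1) \o f (i + 1)) (cdiff X i x) = cdiff Z i ((g i \o f i) x).
Proof. by rewrite /= !cmapE. Qed.

Definition chcomp X Y Z (g : chmap Y Z) (f : chmap X Y) : chmap X Z :=
  @ChMap R X Z (fun i => g i \o f i) (chcomp_subproof g f).

Fact chadd_subproof X Y (f g : chmap X Y) (i : int) (x : X i) :
  (f (i + 1) \+ g (i + 1)) (cdiff X i x) = cdiff Y i ((f i \+ g i) x).
Proof. by rewrite /= linearD !cmapE. Qed.

Definition chadd X Y (f g : chmap X Y) : chmap X Y :=
  @ChMap R X Y (fun i => f i \+ g i) (chadd_subproof f g).

Fact shift_subproof X (i : int) (x : X (i + 1)) :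
  (\- cdiff X (i + 1 + 1)) ((\- cdiff X (i + 1)) x) = 0.
Proof. by rewrite /= linearN cdiffK !oppr0. Qed.

(* X[1] *)
Definition shift X : complex R :=
  @Complex R (fun i => X (i + 1)) (fun i => \- cdiff X (i + 1))
    (@shift_subproof X).

Definition stalk_term (M : lmodType R) (i : int) : lmodType R :=
  if i is Posz 0 then M else 'rV[R]_0.

Fact stalk_subproof (M : lmodType R) (i : int) (x : stalk_term M i) :
  (\0 : {linear stalk_term M (i + 1) -> stalk_term M (i + 1 + 1)})
    ((\0 : {linear stalk_term M i -> stalk_term M (i + 1)}) x) = 0.
Proof. by []. Qed.

(* P_M *)
Definition stalk (M : lmodType R) : complex R :=
  @Complex R (stalk_term M) (fun i => \0) (@stalk_subproof M).

Definition chiso X Y (f : chmap X Y) : Prop :=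
  exists g : chmap Y X,
    homotopic (chcomp g f) (chid X) /\ homotopic (chcomp f g) (chid Y).

Definition isomorphic X Y : Prop := exists f : chmap X Y, chiso f.

Definition zero_object X : Prop := homotopic (chid X) (chzero X X).

Definition quasi_iso X Y (f : chmap X Y) : Prop :=
  (forall (i : int) (x : X (i + 1)), cdiff X (i + 1) x = 0 ->
     (exists y, f (i + 1) x = cdiff Y i y) -> exists z, x = cdiff X i z) /\
  (forall (i : int) (y : Y (i + 1)), cdiff Y (i + 1) y = 0 ->
     exists x : X (i + 1), cdiff X (i + 1) x = 0 /\
       exists z, y = f (i + 1) x + cdiff Y i z).

(* K^-(C); in particular K^-(A) is [Kminus finitely_generated]. *)
Definition Kminus (C : lmodType R -> Prop) X : Prop :=
  (forall i, C (X i)) /\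
  exists n : int, forall i, n < i -> is_zero_module (X i).

(* A predicate P on complexes stands for the full subcategory of the homotopy
   category on the objects satisfying P; a morphism of it is a chain map, two
   chain maps being identified when they are homotopic. *)
Section FullSubcategory.
Variable P : complex R -> Prop.

Definition mono_in X Y (f : chmap X Y) : Prop :=
  forall Z (g h : chmap Z X), P Z ->
    homotopic (chcomp f g) (chcomp f h) -> homotopic g h.

Definition epi_in X Y (f : chmap X Y) : Prop :=
  forall Z (g h : chmap Y Z), P Z ->
    homotopic (chcomp g f) (chcomp h f) -> homotopic g h.

Definition kernel_in X Y K (f : chmap X Y) (i : chmap K X) : Prop :=
  [/\ P K, homotopic (chcomp f i) (chzero K Y) &
      forall Z (g : chmap Z X), P Z -> homotopic (chcomp f g) (chzero Z Y) ->
        exists u : chmap Z K, homotopic (chcomp i u) g /\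
          forall v : chmap Z K, homotopic (chcomp i v) g -> homotopic v u].

Definition cokernel_in X Y Q (f : chmap X Y) (q : chmap Y Q) : Prop :=
  [/\ P Q, homotopic (chcomp q f) (chzero X Q) &
      forall Z (g : chmap Y Z), P Z -> homotopic (chcomp g f) (chzero X Z) ->
        exists u : chmap Q Z, homotopic (chcomp u q) g /\
          forall v : chmap Q Z, homotopic (chcomp v q) g -> homotopic v u].

Definition image_in X Y (f : chmap X Y) I : Prop :=
  exists (Q : complex R) (q : chmap Y Q) (i : chmap I Y),
    cokernel_in f q /\ kernel_in q i.

Definition simple_in L : Prop :=
  [/\ P L, ~ zero_object L &
      forall N (i : chmap N L), P N -> mono_in i -> zero_object N \/ chiso i].

Definition injective_in S : Prop :=
  P S /\
  forall X Y (i : chmap X Y) (f : chmap X S), P X -> P Y -> mono_in i ->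
    exists g : chmap Y S, homotopic (chcomp g i) f.

End FullSubcategory.

(* C is a full additive, strictly full, Karoubi closed subcategory of mod(R). *)
Definition karoubi_subcategory (C : lmodType R -> Prop) : Prop :=
  [/\ (forall M, C M -> finitely_generated M),
      (forall M N, C M -> isomorphic_modules M N -> C N),
      C 'rV[R]_0,
      (forall M N, C M -> C N -> C (M * N)%type) &
      (forall (M N : lmodType R) (i : {linear N -> M}) (p : {linear M -> N}),
         C M -> finitely_generated N -> (forall x, p (i x) = x) -> C N)].

Section Subcategory.
Variable C : lmodType R -> Prop.

Definition approximation X XC (q : chmap XC X) : Prop :=
  [/\ Kminus C XC, quasi_iso q &
      forall Y, Kminus C Y ->
        (forall f g : chmap Y XC,
           homotopic (chcomp q f) (chcomp q g) -> homotopic f g) /\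
        (forall f : chmap Y X,
           exists g : chmap Y XC, homotopic (chcomp q g) f)].

Definition approximating : Prop :=
  forall X, Kminus (@finitely_generated R) X ->
    exists (XC : complex R) (q : chmap XC X), approximation q.

Definition Tle0 X : Prop :=
  Kminus C X /\
  exists Y, [/\ Kminus C Y, forall i, 0 < i -> is_zero_module (Y i) &
                isomorphic X Y].

Definition Tge0 X : Prop :=
  Kminus C X /\
  forall Y (f : chmap (shift Y) X), Tle0 Y -> homotopic f (chzero _ _).

(* H_C *)
Definition heart X : Prop := Tle0 X /\ Tge0 X.

(* L is a simple quotient of P_M in H_C. *)
Definition simple_quotient (M : lmodType R) L : Prop :=
  simple_in heart L /\ exists p : chmap (stalk M) L, epi_in heart p.

End Subcategory.

(* H_A *)
Definition heartA X : Prop :=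
  [/\ forall i, finitely_generated (X i),
      forall i, i < - 2%:Z \/ 0 < i -> is_zero_module (X i) &
      forall (i : int) (x : X (i + 1)), i + 1 < 0 ->
        cdiff X (i + 1) x = 0 -> exists y, x = cdiff X i y].

(* m is a maximal two-sided ideal of the endomorphism ring of X in the homotopy
   category. *)
Definition end_ideal X (m : chmap X X -> Prop) : Prop :=
  [/\ (forall f g, homotopic f g -> m f -> m g),
      m (chzero X X),
      (forall f g, m f -> m g -> m (chadd f g)),
      (forall f g, m f -> m (chcomp g f)) &
      (forall f g, m f -> m (chcomp f g))].

Definition end_maximal_ideal X (m : chmap X X -> Prop) : Prop :=
  [/\ end_ideal m, ~ m (chid X) &
      forall n : chmap X X -> Prop, end_ideal n -> ~ n (chid X) ->
        (forall f, m f -> n f) -> forall f, n f -> m f].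

End Complexes.

Section Duality.
Variables (k : comPzRingType) (R : algType k) (E : lmodType k).

Section CentralScaling.
Variables (M N : lmodType R) (c : k) (f : {linear M -> N}).

Definition kscale (x : M) : N := (c%:A : R) *: f x.

Fact kscale_linear : linear kscale.
Proof.
move=> a x y; rewrite /kscale linearP scalerDr !scalerA; congr (_ *: _ + _).
by rewrite -scalerAl -scalerAr mul1r mulr1.
Qed.

HB.instance Definition _ := GRing.isLinear.Build R M N _ kscale kscale_linear.

End CentralScaling.

Fact chscale_subproof (X Y : complex R) (c : k) (f : chmap X Y)
    (i : int) (x : X i) :
  kscale c (f (i + 1)) (cdiff X i x) = cdiff Y i (kscale c (f i) x).
Proof. by rewrite /kscale cmapE linearZ. Qed.

Definition chscale (X Y : complex R) (c : k) (f : chmap X Y) : chmap X Y :=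
  @ChMap R X Y (fun i => kscale c (f i)) (@chscale_subproof X Y c f).

(* phi is an element of D Hom(X, Y) = Hom_k(Hom(X, Y), E), with Hom taken in
   the homotopy category. *)
Definition dual_form (X Y : complex R) (phi : chmap X Y -> E) : Prop :=
  [/\ (forall f g, homotopic f g -> phi f = phi g),
      (forall f g, phi (chadd f g) = phi f + phi g) &
      (forall (c : k) f, phi (chscale c f) = c *: phi f)].

(* theta is an isomorphism Hom(-, S) -> D Hom(P_M, -) of functors on H_A. *)
Definition serre_isomorphism (M : lmodType R) (S : complex R)
    (theta : forall X : complex R, chmap X S -> chmap (stalk M) X -> E) : Prop :=
  [/\ forall X, heartA X ->
        (forall s, dual_form (theta X s)) /\
        (forall phi, dual_form phi ->
           exists s, forall f, theta X s f = phi f),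
      forall X, heartA X -> forall s t,
        homotopic s t <-> (forall f, theta X s f = theta X t f),
      forall X, heartA X -> forall s t f,
        theta X (chadd s t) f = theta X s f + theta X t f,
      forall X, heartA X -> forall (c : k) s f,
        theta X (chscale c s) f = c *: theta X s f &
      forall X X', heartA X -> heartA X' ->
        forall (u : chmap X' X) (s : chmap X S) (f : chmap (stalk M) X'),
          theta X' (chcomp s u) f = theta X s (chcomp u f)].

(* S is S_A P_M. *)
Definition serre_object (M : lmodType R) (S : complex R) : Prop :=
  injective_in (@heartA R) S /\ exists theta, @serre_isomorphism M S theta.

End Duality.

(* Main.v *)
(* A map out of an object X of K^-(C) lying in degrees <= 0 into an object of
   T_C^{>=0} is determined by, and can be prescribed on, the
   two terms X^-1 -> X^0. Hence an object Y of the heart H_C is controlled by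
   the functor M |-> Hom(P_M, Y) on C, and images and cokernels in H_C of maps
   out of stalk complexes are approximations of explicit three-term complexes
   [ker phi -> A -> B] of H_A.

   Let p : P_C -> L be an epimorphism onto a simple object. Serre duality on
   H_A, together with the fact that E is a cogenerator, provides s : L -> S_C P_C
   with s p <> 0. Simplicity of L makes s a monomorphism, and projectivity of
   P_C with nilpotence of the elements of m gives p m = 0, so s p is a nonzero
   map killed by m. The maps P_C -> S_C P_C killed by m form the dual of
   End(C) / m, which is generated by any nonzero element as an End(C)-module;
   so tau = s p u for an automorphism u, and the kernel of the cokernel of tau
   is L. *)
Require Import Defs.
From HB Require Import structures.
From mathcomp Require Import all_boot all_order all_algebra.
From mathcomp Require Import boolp zify.
From mathcomp Require classical_sets.
Import GRing.Theory.
Local Open Scope ring_scope.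

Set Implicit Arguments.
Unset Strict Implicit.
Unset Printing Implicit Defensive.

(** * Submodules as modules *)

(** Serre duality and the explicit constructions live in H_A, whereas the objects of H_C are
    complexes possibly unbounded to the left. Every object of H_C is therefore exchanged for some
    [ker phi -> A -> B] in H_A that receives the same maps from each P_M with M in C. The kernel
    term must be finitely generated, while [artin_algebra] provides only descending chains of ideals
    in [k]; hence the opening proof that finitely generated modules over an artinian ring are
    noetherian. That any nonzero form generates the dual of End(C)/m is reduced to linear algebra
    over the field k/I, with I the preimage of m in [k]: the part of [E] killed by I is a line, so
    forms with values in it behave like scalar-valued ones. The image of tau is given only by
    universal properties, so its cokernel has to be compared with a constructed one whose exactness
    is known. *)

Section SubmoduleType.
Variables (K : pzRingType) (M : lmodType K).

(** Carrying [hN] as an argument lets the closure instance attach to the predicate itself; [asbool]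
    yields the boolean predicate that subtypes require. *)
Definition subm_pred (N : M -> Prop) (hN : submodule N) : {pred M} :=
  fun x => `[< N x >].

Variables (N : M -> Prop) (hN : submodule N).

Fact subm_pred_closed : submod_closed (subm_pred hN).
Proof.
case: (hN) => N0 ND NZ; split; first exact/asboolP.
by move=> a x y /asboolP Nx /asboolP Ny; apply/asboolP/ND => //; apply: NZ.
Qed.

HB.instance Definition _ :=
  GRing.isSubmodClosed.Build K M (subm_pred hN) subm_pred_closed.

Record subm := Subm { subm_val :> M; subm_valP : subm_val \in subm_pred hN }.

HB.instance Definition _ := [isSub for subm_val].
HB.instance Definition _ := [Choice of subm by <:].
HB.instance Definition _ := [SubChoice_isSubLmodule of subm by <:].

Lemma submP (x : subm) : N (val x).
Proof. by apply/asboolP; exact: (valP x). Qed.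

Lemma subm_surj x : N x -> exists y : subm, val y = x.
Proof. by move=> /asboolP Nx; exists (Subm Nx). Qed.

Definition subm_incl : {linear subm -> M} := val.

Section Lift.
Variables (A : lmodType K) (f : {linear A -> M}) (hf : forall a, N (f a)).
Definition subm_lift_fun a : subm := Subm (introT (asboolP _) (hf a)).
Fact subm_lift_linear : linear subm_lift_fun.
Proof. by move=> a x y; apply: val_inj; rewrite /= linearP. Qed.
HB.instance Definition _ :=
  GRing.isLinear.Build K A subm _ subm_lift_fun subm_lift_linear.
Definition subm_lift : {linear A -> subm} := subm_lift_fun.
End Lift.

End SubmoduleType.

(** * Modules over a commutative artinian ring *)

Section SubmoduleBasics.
Variables (K : pzRingType) (V : lmodType K).
Implicit Types (N W : V -> Prop).

Lemma sub0 N : submodule N -> N 0. Proof. by case. Qed.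
Lemma subD N x y : submodule N -> N x -> N y -> N (x + y).
Proof. by case=> _ + _; apply. Qed.
Lemma subZ N a x : submodule N -> N x -> N (a *: x).
Proof. by case=> _ _; apply. Qed.
Lemma subN N x : submodule N -> N x -> N (- x).
Proof. by move=> hN /(subZ (-1) hN); rewrite scaleN1r. Qed.
Lemma subB N x y : submodule N -> N x -> N y -> N (x - y).
Proof. by move=> hN Nx Ny; apply: subD => //; apply: subN. Qed.

Lemma submodule_cap N W :
  submodule N -> submodule W -> submodule (fun x => N x /\ W x).
Proof.
move=> hN hW; split=> [|x y [? ?] [? ?]|a x [? ?]]; split.
- exact: sub0.
- exact: sub0.
- exact: subD.
- exact: subD.
- exact: subZ.
- exact: subZ.
Qed.

(** Peeling off one generator at a time suits induction on the generators; [lspanE] recovers indexed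
    sums. *)
Fixpoint lspan (s : seq V) (v : V) : Prop :=
  if s is x :: s' then exists a, lspan s' (v - a *: x) else v = 0.

Lemma lspan_submodule s : submodule (lspan s).
Proof.
elim: s => [|x s IH] /=; first by split=> [|x y -> ->|a x ->]; rewrite ?addr0 ?scaler0.
split.
- by exists 0; rewrite scale0r subr0; apply: sub0.
- move=> y z [a ya] [b zb]; exists (a + b).
  by rewrite scalerDl opprD addrACA; apply: subD.
- move=> a y [b yb]; exists (a * b).
  by rewrite -scalerA -scalerBr; apply: subZ.
Qed.

Lemma lspan_mem s x : x \in s -> lspan s x.
Proof.
elim: s => [//|y s IH]; rewrite inE => /predU1P[->|/IH sx] /=.
  by exists 1; rewrite scale1r subrr; apply: sub0 (lspan_submodule s).
by exists 0; rewrite scale0r subr0.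
Qed.

Lemma lspan_sub s N : submodule N -> (forall x, x \in s -> N x) ->
  forall v, lspan s v -> N v.
Proof.
move=> hN; elim: s => [|x s IH] sN v /=; first by move->; apply: sub0.
case=> a /IH; rewrite -{2}(subrK (a *: x) v) => H.
apply: subD => //; first by apply: H => y ys; apply: sN; rewrite inE ys orbT.
by apply: subZ => //; apply: sN; rewrite inE eqxx.
Qed.

Lemma lspan_sum (T : finType) (g : T -> V) (c : T -> K) :
  lspan [seq g t | t <- enum T] (\sum_t c t *: g t).
Proof.
elim/big_ind: _ => [|x y|t _]; first exact: sub0 (lspan_submodule _).
- exact: subD (lspan_submodule _).
- apply: subZ (lspan_submodule _) _; apply: lspan_mem.
  by apply: map_f; rewrite mem_enum.
Qed.

Lemma lspanE s v : lspan s v ->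
  exists c : 'I_(size s) -> K, v = \sum_i c i *: tnth (in_tuple s) i.
Proof.
elim: s v => [|x s IH] v /=; first by move->; exists (fun=> 0); rewrite big_ord0.
case=> a /IH[c] E.
exists (fun i : 'I_(size s).+1 => if unlift ord0 i is Some j then c j else a).
rewrite big_ord_recl unlift_none /= -[v](subrK (a *: x)) addrC E.
congr (_ *: _ + _); apply: eq_bigr => i _; rewrite liftK; congr (_ *: _).
by rewrite !(tnth_nth 0) /=.
Qed.

(** With [x = 1] in a ring this yields maximal ideals; in [fg_mod_maximal] the maximal [W] acts as a
    hyperplane missing [x]. *)
Lemma submodule_Zorn N (x : V) : submodule N -> ~ N x ->
  exists W, [/\ submodule W, forall v, N v -> W v, ~ W x &
    forall W', submodule W' -> (forall v, W v -> W' v) -> ~ W' x ->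
      forall v, W' v -> W v].
Proof.
move=> hN Nx.
pose P W := [/\ submodule W, forall v, N v -> W v & ~ W x].
have PN : P N by [].
pose R (A B : {W | P W}) := `[< forall v, sval A v -> sval B v >].
have [|||[W [hW NW Wx]] Wmax] := @classical_sets.ZL_preorder _ (exist P N PN) R.
- by move=> A; apply/asboolP.
- by move=> A B C /asboolP AB /asboolP BC; apply/asboolP => v /AB /BC.
(* The empty chain is bounded by [N], a nonempty one by its union. *)
- move=> A tot; case: (EM (exists B, A B)) => [[B AB]|A0]; last first.
    by exists (exist P N PN) => B AB; case: A0; exists B.
  pose U v := exists C, A C /\ sval C v.
  have hU : P U.
    split; first split.
    + by exists B; split => //; case: (svalP B) => hB _ _; apply: sub0.
    + move=> y z [C [AC Cy]] [D [AD Dz]].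
      have [/asboolP CD|/asboolP DC] := tot _ _ AC AD.
        exists D; split => //; case: (svalP D) => hD _ _.
        by apply: subD => //; apply: CD.
      exists C; split => //; case: (svalP C) => hC _ _.
      by apply: subD => //; apply: DC.
    + move=> a y [C [AC Cy]]; exists C; split => //.
      by case: (svalP C) => hC _ _; apply: subZ.
    + move=> v Nv; exists B; split => //; case: (svalP B) => _ + _; exact.
    + by case=> C [AC Cx]; case: (svalP C) => _ _; apply.
  exists (exist P U hU) => C AC; apply/asboolP => v /= Cv.
  by exists C.
exists W; split => // W' hW' WW' W'x.
have PW' : P W' by split => // v /NW /WW'.
have := Wmax (exist P W' PW'); rewrite /R /= => H.
by have /asboolP := H (introT (asboolP _) WW').
Qed.

End SubmoduleBasics.

Section Artinian.
Variables (k : comPzRingType).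

Definition dcc (V : lmodType k) : Prop :=
  forall I : nat -> V -> Prop,
    (forall n, submodule (I n)) -> (forall n a, I n.+1 a -> I n a) ->
    exists n, forall m, (n <= m)%N -> forall a, I n a -> I m a.

Lemma desc_le (V : Type) (I : nat -> V -> Prop) :
  (forall n a, I n.+1 a -> I n a) ->
  forall n m, (n <= m)%N -> forall a, I m a -> I n a.
Proof.
move=> dI n m /subnKC <-; elim: (m - n)%N => [|d IH] a; first by rewrite addn0.
by rewrite addnS => /dI /IH.
Qed.

(** A descending chain stops once both its intersections with [lspan s] and its ideals of
    coefficients at [x] have stopped; hence induction on the generators. *)
Lemma dcc_lspan (V : lmodType k) : artinian k ->
  forall (s : seq V) (I : nat -> V -> Prop),
    (forall n, submodule (I n)) -> (forall n a, I n.+1 a -> I n a) ->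
    (forall v, I 0%N v -> lspan s v) ->
    exists n, forall m, (n <= m)%N -> forall a, I n a -> I m a.
Proof.
move=> ark; elim=> [|x s IH] I hI dI sI.
  by exists 0%N => m _ a /sI /= ->; apply: sub0.
have [n1 st1] : exists n, forall m, (n <= m)%N -> forall a : k,
    (exists2 v, I n v & lspan s (v - a *: x)) ->
    (exists2 v, I m v & lspan s (v - a *: x)).
  apply: (ark (fun n a => exists2 v, I n v & lspan s (v - a *: x))).
    move=> n; split.
    - exists 0; first exact: sub0.
      by rewrite scale0r subr0; apply: sub0 (lspan_submodule s).
    - move=> a b [v Iv sv] [w Iw sw]; exists (v + w); first exact: subD.
      by rewrite scalerDl opprD addrACA; apply: subD (lspan_submodule s) _ _.
    - move=> a b [v Iv sv]; exists (a *: v); first exact: subZ.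
      by rewrite -scalerA -scalerBr; apply: subZ (lspan_submodule s) _.
  by move=> n a [v /dI Iv sv]; exists v.
have [n2 st2] := IH (fun n v => I n v /\ lspan s v)
   (fun n => submodule_cap (hI n) (lspan_submodule s))
   (fun n v => fun '(conj a b) => conj (dI n v a) b) (fun v => @proj2 _ _).
exists (maxn n1 n2) => m; rewrite geq_max => /andP[le1 le2] v Iv.
have Iv1 : I n1 v by apply: desc_le Iv => //; apply: leq_maxl.
have Iv2 : I n2 v by apply: desc_le Iv => //; apply: leq_maxr.
have [a sva] := sI _ (desc_le dI (leq0n _) Iv).
have [w Iw swa] := st1 m le1 a (ex_intro2 _ _ v Iv1 sva).
rewrite -[v](subrK w); apply: (subD (hI m) _ Iw).
suff: I m (v - w) /\ lspan s (v - w) by case.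
apply: st2 => //; split.
  by apply: (subB (hI n2) Iv2); apply: (desc_le dI le2 Iw).
have -> : v - w = v - a *: x - (w - a *: x).
  by rewrite opprB addrA subrK.
exact: subB (lspan_submodule s) _ _.
Qed.

Lemma dcc_fg (V : lmodType k) : artinian k ->
  (exists s : seq V, forall v, lspan s v) -> dcc V.
Proof. by move=> ark [s sV] I hI dI; apply: (dcc_lspan ark (s := s)). Qed.

(** Dependent choice: without a minimal member, repeatedly choosing a strictly smaller one would
    give a chain that never stops. *)
Lemma dcc_min (V : lmodType k) (F : (V -> Prop) -> Prop) : dcc V ->
  (forall N, F N -> submodule N) -> (exists N, F N) ->
  exists N, F N /\
    forall N', F N' -> (forall v, N' v -> N v) -> forall v, N v -> N' v.
Proof.
move=> dV hF [N0 FN0]; apply: contrapT => noMin.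
have step (A : {N | F N}) : {B : {N | F N} |
    (forall v, sval B v -> sval A v) /\ ~ (forall v, sval A v -> sval B v)}.
  apply: cid; apply: contrapT => no; apply: noMin; exists (sval A).
  split; first exact: svalP.
  move=> N' FN' N'A; apply: contrapT => nAN'; apply: no.
  by exists (exist _ N' FN').
pose I := fix I n := if n is n'.+1 then sval (step (I n')) else exist F N0 FN0.
have [n st] := dV (fun n => sval (I n)) (fun n => hF _ (svalP (I n)))
  (fun n => proj1 (svalP (step (I n)))).
exact: (proj2 (svalP (step (I n)))) (st n.+1 (leqnSn n)).
Qed.

Lemma maximal_ideal_ext (I : k -> Prop) : ideal I -> ~ I 1 ->
  exists J, maximal_ideal J /\ forall a, I a -> J a.
Proof.
move=> hI I1; have [J [hJ IJ J1 Jmax]] := @submodule_Zorn k k^o I 1 hI I1.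
by exists J; split => //; split => // J' hJ' J'1 JJ'; apply: Jmax.
Qed.

Lemma maximal_idealP (I : k -> Prop) (x : k) : maximal_ideal I -> ~ I x ->
  exists y, I (1 - y * x).
Proof.
case=> hI I1 Imax Ix; apply: contrapT => no.
pose J (a : k) := exists b, I (a - b * x).
have hJ : ideal J.
  split.
  - by exists 0; rewrite mul0r subr0; apply: (sub0 hI).
  - move=> a b [c Ic] [d Id]; exists (c + d).
    by rewrite mulrDl opprD addrACA; apply: (subD hI).
  - move=> a b [c Ic]; exists (a * c).
    rewrite -mulrA [a *: b]/(a * b) -mulrBr; exact: (subZ a hI Ic).
apply: Ix; apply: (Imax J) => //.
  by move=> a Ia; exists 0; rewrite mul0r subr0.
by exists 1; rewrite mul1r subrr; apply: (sub0 hI).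
Qed.

Lemma idealM (I : k -> Prop) a b : ideal I -> I b -> I (a * b).
Proof. by move=> hI Ib; apply: (subZ a hI Ib). Qed.

Section IdealMul.
Variable V : lmodType k.
Implicit Types N W : V -> Prop.

(** The product [IN], taken as the intersection of all submodules containing the products, which
    avoids finite sums. *)
Definition imul (I : k -> Prop) N (v : V) : Prop :=
  forall W, submodule W -> (forall a x, I a -> N x -> W (a *: x)) -> W v.

Lemma imul_submodule I N : submodule (imul I N).
Proof.
split=> [W hW _|x y Ix Iy W hW H|a x Ix W hW H].
- exact: sub0.
- by apply: subD => //; [apply: Ix | apply: Iy].
- by apply: subZ => //; apply: Ix.
Qed.

Lemma imul_mem (I : k -> Prop) N a x : I a -> N x -> imul I N (a *: x).
Proof. by move=> Ia Nx W hW; apply. Qed.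

Lemma imul_mono (I : k -> Prop) N W :
  (forall v, N v -> W v) -> forall v, imul I N v -> imul I W v.
Proof.
move=> NW v; apply; first exact: imul_submodule.
by move=> a x Ia /NW; apply: imul_mem.
Qed.

Lemma imul_sub (I : k -> Prop) N : submodule N -> forall v, imul I N v -> N v.
Proof. by move=> hN v; apply => // a x _; apply: subZ. Qed.

(** The head of [l] multiplies first, so [rcons l I] adds a factor [I] on the outside. *)
Definition imuls (l : seq (k -> Prop)) N := foldl (fun N I => imul I N) N l.

Lemma imuls_mono l N W :
  (forall v, N v -> W v) -> forall v, imuls l N v -> imuls l W v.
Proof.
by elim: l N W => [|I l IH] N W NW //=; apply: IH; apply: imul_mono.
Qed.

Lemma imuls_submodule l N : submodule N -> submodule (imuls l N).
Proof. by elim: l N => [|I l IH] N hN //=; apply: IH; apply: imul_submodule. Qed.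

End IdealMul.

Lemma imul_assoc (V : lmodType k) (I J : k -> Prop) (N : V -> Prop) v :
  imul I (imul J N) v -> imul (@imul k^o I J) N v.
Proof.
have hW := imul_submodule (@imul k^o I J) N.
apply=> // a x Ia Jx.
apply: (Jx (fun x => imul (@imul k^o I J) N (a *: x))); first split.
- by rewrite scaler0; apply: (sub0 hW).
- by move=> y z hy hz; rewrite scalerDr; apply: (subD hW).
- by move=> b y hy; rewrite scalerA mulrC -scalerA; apply: (subZ b hW).
- move=> b y Jb Ny; rewrite scalerA; apply: imul_mem => //.
  exact: (@imul_mem k^o I J a b).
Qed.

Lemma imuls_assoc (V : lmodType k) l (J : k -> Prop) (N : V -> Prop) v :
  imuls l (imul J N) v -> imul (@imuls k^o l J) N v.
Proof.
elim: l J N v => [//|I l IH] J N v /= H; apply: IH.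
by apply: imuls_mono H => w; apply: imul_assoc.
Qed.

Hypothesis ark : artinian k.

Definition all_maximal (l : seq (k -> Prop)) :=
  foldr (fun I P => maximal_ideal I /\ P) True l.

(* In an artinian ring 0 is a product of maximal ideals: a minimal such product
   P satisfies P = PP, and P <> 0 would contradict Nakayama's lemma for an
   ideal A minimal with AP <> 0. *)
Lemma prod_maximal0 : exists l, all_maximal l /\
  forall a, @imuls k^o l (fun=> True) a -> a = 0.
Proof.
have hT : submodule (fun _ : k^o => True) by [].
have [||P [[l [lmax ->]] Pmin]] := @dcc_min k^o
   (fun N => exists l, all_maximal l /\ N = imuls l (fun=> True)) ark.
- by move=> N [l [_ ->]]; apply: imuls_submodule.
- by exists (fun=> True), [::].
exists l; split => // p0 Pp0; apply: contrapT => p0n.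
set P' := @imuls k^o l _ in Pmin Pp0; have hP : submodule P' by apply: imuls_submodule.
have PnP I : maximal_ideal I -> forall a, P' a -> imul I P' a.
  move=> mI; apply: Pmin; last exact: imul_sub.
  exists (rcons l I); split; last by rewrite /imuls foldl_rcons.
  by rewrite /all_maximal foldr_rcons; elim: (l) lmax => [|J l' IH] //= [? /IH].
have PlP l' : all_maximal l' -> forall a, P' a -> imuls l' P' a.
  elim: l' => [//|I l' IH] [mI /IH H] a /H /=; apply: imuls_mono => b.
  exact: PnP.
have PP a : P' a -> @imul k^o P' P' a.
  move=> /(PlP l lmax) H; apply: imuls_assoc.
  by apply: imuls_mono H => b Pb; rewrite -[b]scale1r; apply: imul_mem.
have [||A [[hA [a [p [Aa Pp ap]]]] Amin]] := @dcc_min k^o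
   (fun A => submodule A /\ exists a p, [/\ A a, P' p & a * p <> 0]) ark.
- by move=> N [].
- exists P'; split => //; apply: contrapT => no; apply: p0n.
  apply: (PP _ Pp0 (fun a => a = 0)); first by split=> [|x y -> ->|b x ->];
    rewrite ?addr0 ?scaler0.
  by move=> a b Pa Pb; apply: contrapT => ab; apply: no; exists a, b.
(* Since [P = PP], the ideal [aP] also has a nonzero product with [P]; minimality of [A] puts [a]
   into [aP]. *)
have [|b Pb|q [Pq eq_a]] := Amin (fun b => exists q, P' q /\ b = a * q) _ _ a Aa.
- split.
    split.
    + by exists 0; rewrite mulr0; split => //; apply: (sub0 hP).
    + move=> _ _ [q [Pq ->]] [r [Pr ->]]; exists (q + r).
      by rewrite mulrDr; split => //; apply: (subD hP).
    + move=> b _ [q [Pq ->]]; exists (b * q); split; first exact: idealM.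
      by rewrite mulrCA.
  apply: contrapT => no; apply: ap.
  apply: (PP _ Pp (fun x => a * x = 0)).
    split=> [|x y h1 h2|b x h]; rewrite ?mulr0 ?mulrDr ?h1 ?h2 ?addr0 //.
    by rewrite [b *: x]/(b * x) mulrCA h mulr0.
  move=> x y Px Py; apply: contrapT => axy; apply: no.
  exists (a * x), y; split => //; first by exists x.
  by rewrite -mulrA.
- case: Pb => q [Pq ->]; rewrite mulrC; exact: (subZ q hA Aa).
(* By [PnP], [q] lies in every maximal ideal, so [1 - q] is a unit and [a = a * q] forces
   [a = 0]. *)
have [u uq] : exists u, u * (1 - q) = 1.
  apply: contrapT => no.
  have [||J [[hJ J1 Jmax] IJ]] := @maximal_ideal_ext (fun b => exists u, b = u * (1 - q)).
  + split.
    * by exists 0; rewrite mul0r.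
    * by move=> _ _ [x ->] [y ->]; exists (x + y); rewrite mulrDl.
    * by move=> b _ [x ->]; exists (b * x); rewrite -mulrA.
  + by case=> u e; apply: no; exists u.
  have mJ : maximal_ideal J by split.
  apply: J1; rewrite -[1](subrK q); apply: (subD hJ).
    by apply: (IJ (1 - q)); exists 1; rewrite mul1r.
  apply: (PnP J mJ q Pq J hJ) => b c Jb _.
  by rewrite [_ *: _]mulrC; apply: idealM.
apply: ap; suff -> : a = 0 by rewrite mul0r.
by rewrite -[a]mulr1 -uq mulrCA mulrBr mulr1 -eq_a subrr mulr0.
Qed.

(* N / IN is a vector space over k / I with the descending chain condition. *)
Lemma fg_mod_maximal (V : lmodType k) (N : V -> Prop) (I : k -> Prop) :
  dcc V -> submodule N -> maximal_ideal I ->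
  exists s : seq V, (forall x, x \in s -> N x) /\
    forall x, N x -> exists y, lspan s y /\ imul I N (x - y).
Proof.
move=> dV hN mI; have hIN := imul_submodule I N.
(* [W] is minimal between [IN] and [N] such that finitely many elements generate [N] modulo [W]. If
   some [v] in [W] lay outside [IN], adding [v] to the generators would allow [W] to be cut down by
   a hyperplane missing [v]. *)
have [||W [[hW INW WN [s [sN Ns]]] Wmin]] := @dcc_min V (fun W =>
  [/\ submodule W, forall v, imul I N v -> W v, forall v, W v -> N v &
      exists s : seq V, (forall x, x \in s -> N x) /\
        forall x, N x -> exists y, lspan s y /\ W (x - y)]) dV.
- by move=> W [].
- exists N; split => //; first exact: imul_sub.
  by exists [::]; split => // x Nx; exists 0; rewrite subr0; split.
suff WIN v : W v -> imul I N v.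
  by exists s; split => // x /Ns[y [sy Wy]]; exists y; split => //; apply: WIN.
move=> Wv; apply: contrapT => INv.
have [M [hM INM Mv Mmax]] := submodule_Zorn hIN INv.
apply: (Mv); suff : M v /\ W v by case.
apply: (Wmin (fun v => M v /\ W v)) => //; last by move=> ? [].
split; first exact: submodule_cap.
- by move=> x INx; split; [apply: INM | apply: INW].
- by move=> x [_ /WN].
exists (v :: s); split.
  by move=> x; rewrite inE => /predU1P[->|/sN //]; apply: WN.
move=> x /Ns[y [sy Wxy]].
suff [c [Mc Wc]] : exists c, M (x - y - c *: v) /\ W (x - y - c *: v).
  exists (c *: v + y); split; last by rewrite opprD addrA addrAC; split.
  by exists c; rewrite addrAC subrr add0r.
set z := x - y in Wxy *.
have [Mz|Mz] := EM (M z); first by exists 0; rewrite scale0r subr0.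
(* Maximality of [M] puts [v] into [M + kz]; as [v] is outside [M] while [Iz] is inside, [c] is a
   unit modulo [I]. *)
have [m [c [Mm vE]]] : exists m c, M m /\ v = m + c *: z.
  apply: contrapT => no.
  have hM' : submodule (fun w => exists m c, M m /\ w = m + c *: z).
    split.
    - by exists 0, 0; rewrite scale0r addr0; split => //; apply: sub0.
    - move=> _ _ [m1 [c1 [M1 ->]]] [m2 [c2 [M2 ->]]]; exists (m1 + m2), (c1 + c2).
      by rewrite scalerDl addrACA; split => //; apply: subD.
    - move=> a _ [m1 [c1 [M1 ->]]]; exists (a *: m1), (a * c1).
      by rewrite scalerDr scalerA; split => //; apply: subZ.
  apply: Mz; apply: (Mmax _ hM') => //.
    by move=> w Mw; exists w, 0; rewrite scale0r addr0.
  by exists 0, 1; rewrite add0r scale1r; split => //; apply: sub0.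
have Nz : N z by apply: WN.
have Ic : ~ I c.
  move=> Ic; apply: Mv; rewrite vE; apply: subD => //.
  by apply: INM; apply: imul_mem.
have [b Ib] := maximal_idealP mI Ic.
exists b; split; last by apply: subB => //; apply: subZ.
have -> : z - b *: v = (1 - b * c) *: z - b *: m.
  rewrite vE scalerBl scale1r scalerDr scalerA opprD addrA [RHS]addrAC.
  by [].
by apply: subB => //; [apply: INM; apply: imul_mem | apply: subZ].
Qed.

(** Multiplying [N] successively by maximal ideals reaches 0, and each factor of this filtration is
    finitely generated (Hopkins). *)
Lemma dcc_sub_fg (V : lmodType k) (N : V -> Prop) : dcc V -> submodule N ->
  exists s : seq V, (forall x, x \in s -> N x) /\ forall x, N x -> lspan s x.
Proof.
move=> dV hN; have [l [lmax l0]] := prod_maximal0.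
have {l0} : forall v, imuls l N v -> v = 0.
  move=> v H.
  have {}H : imul (@imuls k^o l (fun=> True)) N v.
    apply: imuls_assoc; apply: imuls_mono H => w Nw.
    by rewrite -[w]scale1r; apply: imul_mem.
  apply: (H (fun v => v = 0)).
    by split=> [|x y -> ->|b x ->]; rewrite ?addr0 ?scaler0.
  by move=> a x /l0 -> _; rewrite scale0r.
elim: l lmax N hN => [_|I l IH [mI /IH{}IH]] N hN /= N0.
  by exists [::]; split.
have [s [sN Ns]] := IH _ (imul_submodule I N) N0.
have [t [tN Nt]] := fg_mod_maximal dV hN mI.
have stN x : x \in s ++ t -> N x.
  by rewrite mem_cat => /orP[/sN|/tN //]; apply: imul_sub.
exists (s ++ t); split => // x /Nt[y [ty /Ns sxy]].
rewrite -[x](subrK y); apply: subD; first exact: lspan_submodule.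
  apply: (lspan_sub (lspan_submodule _)) sxy => z zs.
  by apply: lspan_mem; rewrite mem_cat zs.
apply: (lspan_sub (lspan_submodule _)) ty => z zs.
by apply: lspan_mem; rewrite mem_cat zs orbT.
Qed.

End Artinian.

(** * Finite generation and restriction of scalars *)

Section Pairing.
Variables (K : pzRingType) (A B D : lmodType K).

Section LPair.
Variables (f : {linear A -> B}) (g : {linear A -> D}).
Definition lpair (x : A) : B * D := (f x, g x).
Fact lpair_linear : linear lpair.
Proof. by move=> a x y; rewrite /lpair !linearP. Qed.
HB.instance Definition _ := GRing.isLinear.Build K A (B * D)%type _ lpair lpair_linear.
End LPair.

Section LCopair.
Variables (f : {linear A -> D}) (g : {linear B -> D}).
Definition lcopair (x : A * B) : D := f x.1 + g x.2.
Fact lcopair_linear : linear lcopair.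
Proof.
by move=> a x y; rewrite /lcopair /= !linearP scalerDr addrACA.
Qed.
HB.instance Definition _ := GRing.isLinear.Build K (A * B)%type D _ lcopair lcopair_linear.
End LCopair.

Definition lfst (x : A * B) : A := x.1.
Fact lfst_linear : linear lfst. Proof. by []. Qed.
HB.instance Definition _ := GRing.isLinear.Build K (A * B)%type A _ lfst lfst_linear.
Definition lsnd (x : A * B) : B := x.2.
Fact lsnd_linear : linear lsnd. Proof. by []. Qed.
HB.instance Definition _ := GRing.isLinear.Build K (A * B)%type B _ lsnd lsnd_linear.

End Pairing.

Section FinitelyGenerated.
Variable K : pzRingType.

Lemma fg_lspan (V : lmodType K) :
  finitely_generated V <-> exists s : seq V, forall v, lspan s v.
Proof.
split=> [[n [g gV]]|[s sV]].
  exists [seq g i | i <- enum 'I_n] => v; have [c ->] := gV v.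
  exact: lspan_sum.
by exists (size s), (tnth (in_tuple s)) => v; apply: lspanE.
Qed.

Lemma fg_surj (A B : lmodType K) (f : {linear A -> B}) :
  (forall b, exists a, f a = b) -> finitely_generated A -> finitely_generated B.
Proof.
move=> fs [n [g gA]]; exists n, (f \o g) => b; have [a <-] := fs b.
have [c ->] := gA a; exists c; rewrite linear_sum.
by apply: eq_bigr => i _; rewrite linearZ.
Qed.

Lemma fg_pair (A B : lmodType K) :
  finitely_generated A -> finitely_generated B -> finitely_generated (A * B)%type.
Proof.
move=> [n [g gA]] [m [h hB]]; apply/fg_lspan.
pose e (i : 'I_n + 'I_m) : (A * B)%type :=
  match i with inl i => (g i, 0) | inr j => (0, h j) end.
exists [seq e i | i <- enum {: 'I_n + 'I_m}] => -[a b].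
have [c ->] := gA a; have [d ->] := hB b.
have -> : (\sum_i c i *: g i, \sum_j d j *: h j) =
   \sum_i (match i with inl i => c i | inr j => d j end) *: e i.
  rewrite big_sumType /=.
  have -> : \sum_i c i *: ((g i, 0) : A * B) = (\sum_i c i *: g i, 0).
    rewrite [LHS]surjective_pairing; congr (_, _).
      by rewrite -[LHS]/(lfst _) linear_sum; apply: eq_bigr.
    by rewrite -[LHS]/(lsnd _) linear_sum big1 // => i _; rewrite /lsnd /= scaler0.
  have -> : \sum_i d i *: ((0, h i) : A * B) = (0, \sum_i d i *: h i).
    rewrite [LHS]surjective_pairing; congr (_, _).
      by rewrite -[LHS]/(lfst _) linear_sum big1 // => i _; rewrite /lfst /= scaler0.
    by rewrite -[LHS]/(lsnd _) linear_sum; apply: eq_bigr.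
  by congr (_, _); rewrite /= ?addr0 ?add0r.
exact: lspan_sum.
Qed.

Lemma fg_rV0 : finitely_generated 'rV[K]_0.
Proof.
by exists 0%N, (fun _ => 0) => x; exists (fun _ => 0); rewrite big_ord0 thinmx0.
Qed.

Lemma fg_ffun (V : lmodType K) n :
  finitely_generated V -> finitely_generated {ffun 'I_n -> V}.
Proof.
move=> [m [g gV]]; apply/fg_lspan.
pose e i j : {ffun 'I_n -> V} := [ffun i' => if i' == i then g j else 0].
exists [seq e t.1 t.2 | t <- enum {: 'I_n * 'I_m}] => v.
have /choice[c cE] : forall i, exists c : 'I_m -> K, v i = \sum_j c j *: g j.
  by move=> i; apply: gV.
have -> : v = \sum_i \sum_j c i j *: e i j.
  apply/ffunP => i; rewrite sum_ffunE cE (bigD1 i) //= [X in _ + X]big1 ?addr0.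
    by rewrite sum_ffunE; apply: eq_bigr => j _; rewrite !ffunE eqxx.
  move=> i' i'i; rewrite sum_ffunE big1 // => j _.
  by rewrite !ffunE eq_sym (negPf i'i) scaler0.
by rewrite pair_bigA; apply: (lspan_sum (fun t => e t.1 t.2) (fun t => c t.1 t.2)).
Qed.

End FinitelyGenerated.

Section RestrictScalars.
Variables (k : comPzRingType) (R : algType k).

(** An alias, so that the same carrier can bear a [k]-module structure beside its [R]-module
    structure. *)
Definition kmod (M : lmodType R) : Type := M.

Section KmodStructure.
Variable M : lmodType R.
HB.instance Definition _ := GRing.Zmodule.on (kmod M).
Definition kmod_scale (c : k) (x : kmod M) : kmod M := (c%:A : R) *: (x : M).
Fact kmod_scaleA a b x : kmod_scale a (kmod_scale b x) = kmod_scale (a * b) x.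
Proof. by rewrite /kmod_scale scalerA -scalerAl mul1r scalerA. Qed.
Fact kmod_scale1 : left_id 1 kmod_scale.
Proof. by move=> x; rewrite /kmod_scale !scale1r. Qed.
Fact kmod_scaleDr : right_distributive kmod_scale +%R.
Proof. by move=> a x y; rewrite /kmod_scale scalerDr. Qed.
Fact kmod_scaleDl v : {morph kmod_scale^~ v: a b / a + b}.
Proof. by move=> a b; rewrite /kmod_scale !scalerDl. Qed.
HB.instance Definition _ := GRing.Zmodule_isLmodule.Build k (kmod M)
  kmod_scaleA kmod_scale1 kmod_scaleDr kmod_scaleDl.
End KmodStructure.

Hypothesis hR : artin_algebra R.

Lemma kmod_fg (M : lmodType R) : finitely_generated M -> finitely_generated (kmod M : lmodType k).
Proof.
case: hR => _ _ _ [r [b bR]] [n [g gM]]; apply/fg_lspan.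
exists [seq (b t.2 *: g t.1 : kmod M) | t <- enum {: 'I_n * 'I_r}] => v.
have [c vE] := gM v.
have /choice[d dE] : forall i, exists d : 'I_r -> k, c i = \sum_j d j *: b j.
  by move=> i; apply: bR.
have -> : v = \sum_i \sum_j d i j *: (b j *: g i : kmod M).
  rewrite vE; apply: eq_bigr => i _; rewrite dE scaler_suml.
  apply: eq_bigr => j _; rewrite -[RHS]/(((d i j)%:A : R) *: (b j *: g i)).
  by rewrite scalerA -scalerAl mul1r.
rewrite pair_bigA.
exact: (lspan_sum (fun t => b t.2 *: g t.1 : kmod M) (fun t => d t.1 t.2)).
Qed.

(** A finitely generated [R]-module is finitely generated over the artinian ring [k]; generators of
    the submodule over [k] also generate it over [R]. *)
Lemma artin_subfg (M : lmodType R) (N : M -> Prop) (hN : submodule N) :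
  finitely_generated M -> finitely_generated (subm hN).
Proof.
move=> /kmod_fg /fg_lspan fgM; have [_ _ ark _] := hR.
have hN' : @submodule k (kmod M) N.
  by case: (hN) => N0 ND NZ; split => // a x; apply: NZ.
have [s [sN Ns]] := dcc_sub_fg ark (dcc_fg ark fgM) hN'.
have h i : N (tnth (in_tuple s) i) by apply: sN; apply: mem_tnth.
have /choice[g gE] : forall i, exists y : subm hN, val y = tnth (in_tuple s) i.
  by move=> i; apply: subm_surj.
exists (size s), g => x; have [c xE] := lspanE (Ns _ (submP x)).
exists (fun i => (c i)%:A); apply: val_inj.
rewrite -[RHS]/(subm_incl hN _) linear_sum xE; apply: eq_bigr => i _.
by rewrite linearZ; congr (_ *: _); rewrite -gE.
Qed.

End RestrictScalars.

(** * The injective hull of the residue ring, and endomorphism rings *)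

Section Hull.
Variables (k : comPzRingType) (E : lmodType k).

Lemma maximal_ideal_prime (I : k -> Prop) a b :
  maximal_ideal I -> I (a * b) -> I a \/ I b.
Proof.
move=> mI Iab; have [Ia|Ia] := EM (I a); [by left | right].
have [y Iy] := maximal_idealP mI Ia; case: (mI) => hI _ _.
have -> : b = b * (1 - y * a) + y * (a * b) by rewrite mulrBr mulr1 mulrCA [b * a]mulrC subrK.
by apply: (subD hI); apply: idealM.
Qed.

Hypothesis hE : injective_hull_residue E.

(** The part of [E] killed by [I] is a line over [k/I]: by essentiality each of its nonzero elements
    comes from [k / rad k], where the part killed by [I] is such a line. *)
Lemma hull_socle (I : k -> Prop) (e e' : E) : maximal_ideal I -> e <> 0 ->
  (forall a, I a -> a *: e = 0) -> (forall a, I a -> a *: e' = 0) ->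
  exists a, e' = a *: e.
Proof.
move=> mI e0 Ie Ie'; have [_ [j [jrad ess]]] := hE.
have jM a b : j (a * b) = a *: j b by rewrite -linearZ.
have lift (x : E) : x <> 0 -> (forall a, I a -> a *: x = 0) ->
    exists2 y, j y = x & ~ radical y /\ (forall a, I a -> radical (a * y)).
  move=> x0 Ix.
  have [||a [c ja] ja0] := ess (fun y => exists c, y = c *: x).
  - split.
    + by exists 0; rewrite scale0r.
    + by move=> _ _ [c ->] [d ->]; exists (c + d); rewrite scalerDl.
    + by move=> b _ [c ->]; exists (b * c); rewrite scalerA.
  - by exists x => //; exists 1; rewrite scale1r.
  have Ic : ~ I c by move=> /Ix cx; apply: ja0; rewrite ja cx.
  have [b Ib] := maximal_idealP mI Ic.
  have jx : j (b * a) = x.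
    rewrite jM ja scalerA; apply/eqP; rewrite eq_sym -subr_eq0.
    by rewrite -{1}[x]scale1r -scalerBl Ix.
  exists (b * a) => //; split; first by move=> /jrad; rewrite jx.
  by move=> d Id; apply/jrad; rewrite jM jx Ix.
have [->|e'0] := EM (e' = 0); first by exists 0; rewrite scale0r.
have [x jx [xrad Ixrad]] := lift e e0 Ie.
have [y jy [yrad Iyrad]] := lift e' e'0 Ie'.
(* Otherwise [x * x] lies in the radical, hence so does [x], the radical being an intersection of
   prime ideals. *)
have Ix : ~ I x.
  move=> /Ixrad xx; apply: xrad => J mJ.
  by case: (maximal_ideal_prime mJ (xx J mJ)).
have [b Ib] := maximal_idealP mI Ix.
exists (b * y); rewrite -jx -jM -jy; apply/eqP; rewrite -subr_eq0 -linearB.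
apply/eqP/jrad; have -> : y - b * y * x = (1 - b * x) * y by rewrite mulrBl mul1r mulrAC.
exact: Iyrad.
Qed.

Hypothesis ark : artinian k.

(** Take [a] outside [I] in an ideal [J] minimal among those not contained in [I]. By minimality [J]
    lies in every other maximal ideal, so [Ia] lies in the radical and [j a] is killed by [I]. *)
Lemma hull_socle_neq0 (I : k -> Prop) : maximal_ideal I ->
  exists2 e : E, e <> 0 & forall a, I a -> a *: e = 0.
Proof.
move=> mI; have [_ [j [jrad _]]] := hE; have [hI I1 Imax] := mI.
have [||J [[hJ JI] Jmin]] := @dcc_min k k^o
  (fun J => ideal J /\ exists2 a, J a & ~ I a) ark.
- by move=> N [].
- by exists (fun _ => True); split => //; exists 1.
case: JI => a Ja Ia; exists (j a).
  by move=> /jrad ra; apply: Ia; apply: ra.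
move=> b Ib; rewrite -linearZ; apply/jrad => I' mI'.
have [[c I'c Ic]|no] := EM (exists2 c, I' c & ~ I c); last first.
  have [hI' I'1 I'max] := mI'.
  have I'I x : I' x -> I x by move=> I'x; apply: contrapT => Ix; apply: no; exists x.
  apply: (I'max I) => //; rewrite [b *: a]mulrC; exact: idealM.
apply: idealM; first by case: mI'.
suff : I' a /\ J a by case.
have [hI' _ _] := mI'.
apply: (Jmin (fun x => I' x /\ J x)) => //; last by move=> ? [].
split; first exact: submodule_cap.
exists (c * a); first by split; [rewrite mulrC|]; apply: idealM.
by move=> /(maximal_ideal_prime mI)[].
Qed.

(** The annihilator of [x] modulo [N] lies in a maximal ideal [I]. Sending [x] to a nonzero [e]
    killed by [I] and [N] to 0 is well defined on [N + kx], and injectivity extends it. *)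
Lemma hull_cogenerator (V : lmodType k) (N : V -> Prop) (x : V) :
  submodule N -> ~ N x ->
  exists g : {linear V -> E}, (forall v, N v -> g v = 0) /\ g x <> 0.
Proof.
move=> hN Nx.
have [||I [mI NI]] := @maximal_ideal_ext k (fun a => N (a *: x)).
- split=> [|a b|a b].
  + by rewrite scale0r; apply: (sub0 hN).
  + by rewrite scalerDl; apply: (subD hN).
  + by rewrite -scalerA; apply: (subZ _ hN).
- by rewrite scale1r.
have [e e0 Ie] := hull_socle_neq0 mI.
pose W v := exists c, N (v - c *: x).
have hW : submodule W.
  split.
  - by exists 0; rewrite scale0r subr0; apply: (sub0 hN).
  - move=> v w [c Nv] [d Nw]; exists (c + d).
    by rewrite scalerDl opprD addrACA; apply: (subD hN).
  - move=> a v [c Nv]; exists (a * c).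
    by rewrite -scalerA -scalerBr; apply: (subZ _ hN).
have /choice[c cE] : forall v : subm hW, exists c, N (val v - c *: x).
  by move=> v; exact: (submP v).
(* The coefficient [c v] is an arbitrary choice; only [c v *: e] is determined by [v]. *)
have cU (v : subm hW) d : N (val v - d *: x) -> c v *: e = d *: e.
  move=> Nv; apply/eqP; rewrite -subr_eq0 -scalerBl; apply/eqP/Ie/NI.
  have -> : (c v - d) *: x = (val v - d *: x) - (val v - c v *: x).
    by rewrite scalerBl opprB [RHS]addrC addrA subrK.
  exact: (subB hN).
have f_lin : linear (fun v : subm hW => c v *: e).
  move=> a v w; rewrite (cU _ (a * c v + c w)) ?scalerDl ?scalerA //.
  rewrite [val _](linearP (subm_incl hW)) -scalerA opprD addrACA.
  by rewrite -scalerBr; apply: (subD hN _ (cE w)); apply: (subZ _ hN (cE v)).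
pose f : {linear subm hW -> E} := HB.pack (fun v : subm hW => c v *: e)
  (GRing.isLinear.Build k (subm hW) E _ (fun v : subm hW => c v *: e) f_lin).
have [Einj _] := hE.
have [g gE] := Einj _ _ (subm_incl hW) f val_inj.
exists g; split => [v Nv|gx].
  have [|w wE] := @subm_surj _ _ _ hW v.
    by exists 0; rewrite scale0r subr0.
  by rewrite -wE gE /f /= (cU _ 0) ?scale0r // wE subr0.
have [|w wE] := @subm_surj _ _ _ hW x.
  by exists 1; rewrite scale1r subrr; apply: (sub0 hN).
apply: e0; rewrite -[e]scale1r -gx -wE gE /f /= -(cU w 1) //.
by rewrite wE scale1r subrr; apply: (sub0 hN).
Qed.

End Hull.

(** * Chain conditions on endomorphisms and Fitting's lemma *)

Section LinIter.
Variables (R : pzRingType) (M : lmodType R).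

Fixpoint lin_iter n (f : {linear M -> M}) : {linear M -> M} :=
  if n is n'.+1 then f \o lin_iter n' f else idfun.

Lemma lin_iterD m n f x : lin_iter (m + n) f x = lin_iter m f (lin_iter n f x).
Proof. by elim: m => [|m IH] //=; rewrite IH. Qed.

End LinIter.

Section Endomorphisms.
Variables (k : comPzRingType) (R : algType k) (M : lmodType R).
Hypotheses (hR : artin_algebra R) (fgM : finitely_generated M).
Local Notation endo := {linear M -> M}.

Definition end_submodule (S : endo -> Prop) : Prop :=
  [/\ S \0, (forall f g : endo, S f -> S g -> S (f \+ g)),
      (forall (c : k) (f : endo), S f -> S (kscale c f)) &
      (forall f g : endo, f =1 g -> S f -> S g)].

(** Values on generators determine an endomorphism, so a finite power of [M] over [k] supplies the
    chain condition. Endomorphisms are compared by [=1] throughout. *)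
Lemma end_dcc_embed : exists (V : lmodType k) (e : endo -> V), dcc V /\
  [/\ forall f g : endo, f =1 g <-> e f = e g, e \0 = 0,
      forall f g : endo, e (f \+ g) = e f + e g &
      forall (c : k) (f : endo), e (kscale c f) = c *: e f].
Proof.
have [n [g gM]] := fgM; have [_ _ ark _] := hR.
exists {ffun 'I_n -> kmod M}, (fun f => [ffun i => f (g i) : kmod M]); split.
  by apply: dcc_fg => //; apply/fg_lspan/fg_ffun/kmod_fg.
split.
- move=> f h; split => [fh|/ffunP fh].
    by apply/ffunP => i; rewrite !ffunE fh.
  move=> x; have [c ->] := gM x; rewrite !linear_sum; apply: eq_bigr => i _.
  by have := fh i; rewrite !ffunE !linearZ => ->.
- by apply/ffunP => i; rewrite !ffunE.
- by move=> f h; apply/ffunP => i; rewrite !ffunE.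
- by move=> c f; apply/ffunP => i; rewrite !ffunE.
Qed.

Lemma end_image_submodule (V : lmodType k) (e : endo -> V) (S : endo -> Prop) :
  [/\ forall f g : endo, f =1 g <-> e f = e g, e \0 = 0,
      forall f g : endo, e (f \+ g) = e f + e g &
      forall (c : k) (f : endo), e (kscale c f) = c *: e f] ->
  end_submodule S -> submodule (fun v => exists2 f, S f & v = e f).
Proof.
move=> [_ e0 eD eZ] [S0 SD SZ _]; split.
- by exists \0.
- by move=> _ _ [f Sf ->] [g Sg ->]; exists (f \+ g); [apply: SD | rewrite eD].
- by move=> a _ [f Sf ->]; exists (kscale a f); [apply: SZ | rewrite eZ].
Qed.

Lemma end_dcc (S : nat -> endo -> Prop) :
  (forall n, end_submodule (S n)) -> (forall n f, S n.+1 f -> S n f) ->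
  exists n, forall m, (n <= m)%N -> forall f, S n f -> S m f.
Proof.
move=> hS dS; have [V [e [dV he]]] := end_dcc_embed.
have [n st] := dV (fun n v => exists2 f, S n f & v = e f)
  (fun n => end_image_submodule he (hS n))
  (fun n v => fun '(ex_intro2 f Sf vE) => ex_intro2 _ _ f (dS n f Sf) vE).
exists n => m nm f Sf; have [g Sg fg] := st m nm (e f) (ex_intro2 _ _ f Sf erefl).
have [_ _ _ ext] := hS m; apply: ext Sg => x.
by case: he => inj _ _ _; apply/esym; move: x; apply/inj.
Qed.

Lemma end_dcc_min (F : (endo -> Prop) -> Prop) :
  (forall S, F S -> end_submodule S) -> (exists S, F S) ->
  exists S, F S /\
    forall S', F S' -> (forall f, S' f -> S f) -> forall f, S f -> S' f.
Proof.
move=> hF [S0 FS0]; have [V [e [dV he]]] := end_dcc_embed.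
have [||N [[S [FS NE]] Nmin]] := @dcc_min k V
  (fun N => exists S, F S /\ N = (fun v => exists2 f, S f & v = e f)) dV.
- by move=> N [S [/hF hS ->]]; apply: end_image_submodule.
- by exists (fun v => exists2 f, S0 f & v = e f), S0.
exists S; split => // S' FS' S'S f Sf.
have [|||g S'g fg] := Nmin (fun v => exists2 f, S' f & v = e f) _ _ (e f).
- by exists S'.
- by move=> v [g /S'S Sg ->]; rewrite NE; exists g.
- by rewrite NE; exists f.
have [_ _ _ ext] := hF _ FS'; apply: ext S'g.
by case: he => inj _ _ _ x; apply/esym; move: x; apply/inj.
Qed.

Lemma comp_kscale (c : k) (f g : endo) x : f (kscale c g x) = kscale c (f \o g) x.
Proof. by rewrite /kscale /= linearZ. Qed.

(* From f^n = g f^2n = f^2n h one gets the idempotent g f^n = f^n h. *)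
Lemma indecomposable_local : indecomposable M -> forall f : endo,
  bijective f \/ exists n, forall x, lin_iter n f x = 0.
Proof.
move=> [M0 Mind] f.
have [||n1 st1] := end_dcc (S := fun n h => exists g : endo, h =1 g \o lin_iter n f).
- move=> n; split=> [|h1 h2 [g1 E1] [g2 E2]|c h [g E]|h1 h2 E [g E1]].
  + by exists \0.
  + by exists (g1 \+ g2) => x /=; rewrite E1 E2.
  + by exists (kscale c g) => x; rewrite /= /kscale E.
  + by exists g => x; rewrite -E E1.
- move=> n h [g E]; exists (g \o f) => x; rewrite E -addn1 /=.
  by rewrite addn1.
have [||n2 st2] := end_dcc (S := fun n h => exists g : endo, h =1 lin_iter n f \o g).
- move=> n; split=> [|h1 h2 [g1 E1] [g2 E2]|c h [g E]|h1 h2 E [g E1]].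
  + by exists \0 => x; rewrite /= linear0.
  + by exists (g1 \+ g2) => x /=; rewrite linearD E1 E2.
  + by exists (kscale c g) => x; rewrite /= /kscale E linearZ.
  + by exists g => x; rewrite -E E1.
- by move=> n h [g E]; exists (f \o g) => x; rewrite E -addn1; apply: lin_iterD.
(* The successor makes [f] a factor of [F], so that invertibility of [F] passes to [f]. *)
pose n := (maxn n1 n2).+1; have [F FE] : exists F, F = lin_iter n f by exists (lin_iter n f).
have le1 : (n1 <= n)%N by rewrite leqW ?leq_maxl.
have le2 : (n2 <= n)%N by rewrite leqW ?leq_maxr.
have [g gE] : exists g : endo, F =1 g \o lin_iter (n + n) f.
  rewrite FE; apply: st1; first exact: leq_trans le1 (leq_addr _ _).
  by exists (lin_iter (n - n1) f) => x; rewrite /= -lin_iterD subnK.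
have [h hE] : exists h : endo, F =1 lin_iter (n + n) f \o h.
  rewrite FE; apply: st2; first exact: leq_trans le2 (leq_addr _ _).
  by exists (lin_iter (n - n2) f) => x; rewrite /= -lin_iterD subnKC.
have {}gE x : F x = g (F (F x)) by rewrite {1}gE /= lin_iterD FE.
have {}hE x : F x = F (F (h x)) by rewrite {1}hE /= lin_iterD FE.
have ghE x : g (F x) = F (h x) by rewrite hE -gE.
have idem x : g (F (g (F x))) = g (F x) by rewrite (ghE x) -gE.
have h1 : submodule (fun x => g (F x) = x).
  split=> [|x y Ex Ey|a x Ex]; first by rewrite !linear0.
    by rewrite !linearD Ex Ey.
  by rewrite !linearZ /= Ex.
have h2 : submodule (fun x => g (F x) = 0).
  split=> [|x y Ex Ey|a x Ex]; first by rewrite !linear0.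
    by rewrite !linearD Ex Ey addr0.
  by rewrite !linearZ /= Ex scaler0.
pose p1 : {linear M -> subm h1} := subm_lift h1 (f := g \o F) idem.
have hq x : g (F ((idfun \- (g \o F)) x)) = 0 by rewrite /= !linearB /= idem subrr.
pose p2 : {linear M -> subm h2} := subm_lift h2 (f := idfun \- (g \o F)) hq.
have iso : isomorphic_modules M (subm h1 * subm h2)%type.
  exists (lpair p1 p2); exists (fun y => val y.1 + val y.2).
    by move=> x; rewrite /= addrC subrK.
  move=> [y1 y2]; have E1 := submP y1; have E2 := submP y2.
  have EF : g (F (val y1 + val y2)) = val y1.
    by rewrite [F _]linearD [g _]linearD E1 E2 addr0.
  rewrite [LHS]surjective_pairing; congr (_, _); apply: val_inj; rewrite /= EF //.
  by rewrite addrC addKr.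
(* [M] is the sum of the image and the kernel of the idempotent [g F]. A zero image gives [F = 0], a
   zero kernel gives [g F = 1]. *)
case: (Mind _ _ iso) => Z.
  right; exists n => x; rewrite -FE gE.
  by have /(congr1 val) /= := Z (p1 (F x)).
left; have gF x : g (F x) = x.
  by apply/esym/eqP; rewrite -subr_eq0; apply/eqP; have /(congr1 val) := Z (p2 x).
have finj : injective f.
  move=> y z yz; rewrite -[y]gF -[z]gF; congr (g _).
  by rewrite FE /n -addn1 !lin_iterD /= yz.
have fK x : f (lin_iter (maxn n1 n2) f (h x)) = x by rewrite -[RHS]gF ghE FE.
by exists (lin_iter (maxn n1 n2) f \o h) => x /=; [apply: finj|]; rewrite fK.
Qed.

End Endomorphisms.

(** * Local endomorphism rings and the dual of End(M)/m *)

Section LocalEndomorphisms.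
Variables (k : comPzRingType) (R : algType k) (M : lmodType R).
Hypotheses (hR : artin_algebra R) (fgM : finitely_generated M).
Local Notation endo := {linear M -> M}.

Definition lin_ideal (m : endo -> Prop) : Prop :=
  [/\ (forall f g : endo, f =1 g -> m f -> m g), m \0,
      (forall f g : endo, m f -> m g -> m (f \+ g)),
      (forall f g : endo, m f -> m (g \o f)) &
      (forall f g : endo, m f -> m (f \o g))].

Lemma lin_inverse (f : endo) : bijective f ->
  exists g : endo, cancel f g /\ cancel g f.
Proof.
case=> g fK gK; have g_lin : linear g.
  by move=> a x y; apply: (can_inj fK); rewrite linearP !gK.
pose G : endo := HB.pack g (GRing.isLinear.Build R M M _ g g_lin).
by exists G.
Qed.

Lemma lin_iter_inj n (f : endo) : injective f -> injective (lin_iter n f).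
Proof. by move=> fI; elim: n => [|n IH] x y //= /fI /IH. Qed.

Lemma lin_iter_surj n (f : endo) :
  (forall y, exists x, f x = y) -> forall y, exists x, lin_iter n f x = y.
Proof.
move=> fS; elim: n => [|n IH] y; first by exists y.
by have [z <-] := fS y; have [x <-] := IH z; exists x.
Qed.

Hypothesis indM : indecomposable M.

Lemma nilpotent_not_inj (f : endo) :
  (exists n, forall x, lin_iter n f x = 0) -> ~ injective f.
Proof.
case=> n f0 fI; case: indM => M0 _; apply: M0 => x.
by apply: (@lin_iter_inj n f fI); rewrite !f0.
Qed.

Lemma nilpotent_not_surj (f : endo) :
  (exists n, forall x, lin_iter n f x = 0) -> ~ (forall y, exists x, f x = y).
Proof.
case=> n f0 fS; case: indM => M0 _; apply: M0 => y.
by have [x <-] := lin_iter_surj n fS y.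
Qed.

Lemma not_bij_nilpotent (f : endo) : ~ bijective f ->
  exists n, forall x, lin_iter n f x = 0.
Proof. by move=> nb; case: (indecomposable_local hR fgM indM f). Qed.

Lemma bij_surj (f : endo) : bijective f -> forall y, exists x, f x = y.
Proof. by case=> g _ fK y; exists (g y). Qed.

(** Non-invertible maps are nilpotent, hence neither injective nor surjective. For sums: if [h]
    inverts [f + g], a vector killed by [h g] is fixed by the nilpotent [h f] and so vanishes,
    making [h g] injective. *)
Lemma not_bij_lin_ideal : lin_ideal (fun f : endo => ~ bijective f).
Proof.
have compl (f g : endo) : ~ bijective f -> ~ bijective (g \o f).
  move=> /not_bij_nilpotent nf /bij_inj gf; apply: (nilpotent_not_inj nf).
  by move=> x y xy; apply: gf; rewrite /= xy.
split=> //.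
- by move=> f g fg nf bg; apply: nf; apply: (eq_bij bg) => x; rewrite fg.
- by move=> /bij_inj b0; apply: (@nilpotent_not_inj \0); [exists 1%N|].
- move=> f g nf ng /lin_inverse[h [hK _]].
  have /not_bij_nilpotent[n hf0] := compl f h nf.
  apply: (nilpotent_not_inj (not_bij_nilpotent (compl g h ng))).
  apply: raddf_inj => x /= hgx; rewrite -(hf0 x); elim: n {hf0} => [//|n IH] /=.
  by rewrite -IH -{1}[x]hK /= linearD hgx addr0.
- move=> f g /not_bij_nilpotent nf /bij_surj fg; apply: (nilpotent_not_surj nf).
  by move=> y; have [x <-] := fg y; exists (g x).
Qed.

Variable m : endo -> Prop.
Hypotheses (hm : lin_ideal m) (m1 : ~ m idfun)
  (mmax : forall n, lin_ideal n -> ~ n idfun -> (forall f, m f -> n f) ->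
     forall f, n f -> m f).

(** A proper ideal contains no invertible map, and the non-invertible maps already form a proper
    ideal, so maximality identifies the two. *)
Lemma maximal_ideal_bij f : m f <-> ~ bijective f.
Proof.
have mN g : m g -> ~ bijective g.
  have [ext _ _ mc _] := hm; move=> mg /lin_inverse[h [hK _]]; apply: m1.
  by apply: ext (mc _ h mg) => x /=; rewrite hK.
split; first exact: mN.
apply: (mmax not_bij_lin_ideal) => // nb; apply: nb.
by exists idfun.
Qed.

Lemma maximal_ideal_nilpotent f : m f -> exists n, forall x, lin_iter n f x = 0.
Proof. by move/maximal_ideal_bij/not_bij_nilpotent. Qed.

Variable E : lmodType k.
Hypothesis hE : injective_hull_residue E.

(** An element of the dual of End(M)/m, written as a form on End(M). *)
Definition ideal_form (phi : endo -> E) : Prop :=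
  [/\ (forall f g : endo, f =1 g -> phi f = phi g),
      (forall f g : endo, phi (f \+ g) = phi f + phi g),
      (forall (c : k) (f : endo), phi (kscale c f) = c *: phi f) &
      (forall f, m f -> phi f = 0)].

Let I (c : k) : Prop := m (kscale c (idfun : endo)).

(** A scalar [a] outside [I] acts bijectively, and the chain of the ideals [a ^+ n * k] stops;
    cancelling [a ^+ n] on [M] inverts [a] modulo [I]. *)
Lemma scalar_ideal_maximal : maximal_ideal I.
Proof.
have [mext m0 mD ml mr] := hm; have [_ _ ark _] := hR.
have IE c : I c <-> ~ bijective (fun x : M => (c%:A : R) *: x).
  exact: maximal_ideal_bij.
have hI : ideal I.
  split.
  - by apply: mext m0 => x; rewrite /= /kscale /= !scale0r.
  - move=> a b Ia Ib; apply: mext (mD _ _ Ia Ib) => x.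
    by rewrite /= /kscale /= !scalerDl.
  - move=> a b Ib; apply: mext (ml _ (kscale a idfun) Ib) => x.
    by rewrite /= /kscale /= scalerA -scalerAl mul1r scalerA.
split=> //; first by move=> I1; apply: m1; apply: mext I1 => x; rewrite /= /kscale /= !scale1r.
move=> J hJ J1 IJ a Ja; apply: contrapT => nIa; apply: J1.
have [||n st] := ark (fun n b => exists c, b = a ^+ n * c).
- move=> n; split; first by exists 0; rewrite mulr0.
    by move=> _ _ [c ->] [d ->]; exists (c + d); rewrite mulrDr.
  by move=> b _ [c ->]; exists (b * c); rewrite [b *: _]/(b * _) mulrCA.
- by move=> n b [c ->]; exists (a * c); rewrite mulrA -exprSr.
have [|b bE] := st n.+1 (leqnSn n) (a ^+ n); first by exists 1; rewrite mulr1.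
(* From [a ^+ n = a ^+ n.+1 * b] and injectivity of [a] on [M], the scalar [1 - a * b] acts as
   zero. *)
have Iab : I (1 - a * b).
  move: nIa => /IE/contrapT bija; apply: mext m0 => x /=; rewrite /= /kscale /=.
  have an0 : ((a ^+ n * (1 - a * b))%:A : R) = 0.
    by rewrite mulrBr mulr1 mulrA -exprSr -bE subrr scale0r.
  have : ((a ^+ n)%:A : R) *: (((1 - a * b)%:A : R) *: x) = 0.
    by rewrite scalerA -scalerAl mul1r scalerA an0 scale0r.
  move: (_ *: x) => y; elim: (n) y => [|n' IH] y.
    by rewrite expr0 !scale1r.
  move=> H; apply: IH; apply: (bij_inj bija); rewrite scaler0 -H exprS.
  by rewrite scalerA -scalerAl mul1r scalerA.
rewrite -[1](subrK (a * b)); apply: (subD hJ); first exact: IJ.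
by rewrite mulrC; apply: idealM.
Qed.

(** Together with [hull_socle] this makes any two values of ideal forms comparable by a scalar. *)
Lemma ideal_form_socle phi f c : ideal_form phi -> I c -> c *: phi f = 0.
Proof.
case=> _ _ phiZ phim Ic; rewrite -phiZ; apply: phim.
have [mext _ _ _ mr] := hm.
by apply: mext (mr _ f Ic) => x.
Qed.

(** The common kernel of the translates of [phi] by the members of [l], finitely many elements of
    the submodule generated by [phi]. *)
Fixpoint joint_kernel (phi : endo -> E) (l : seq endo) (f : endo) : Prop :=
  if l is u :: l' then phi (u \o f) = 0 /\ joint_kernel phi l' f else True.

Lemma joint_kernel_submodule phi l : ideal_form phi ->
  end_submodule (joint_kernel phi l).
Proof.
move=> [ext phiD phiZ phim]; have [_ m0 _ _ _] := hm.
elim: l => [//|u l [h1 h2 h3 h4]] /=; split.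
- split => //; apply: phim; have [mext _ _ _ _] := hm.
  by apply: mext m0 => x; rewrite /= linear0.
- move=> f g [f1 /h2 f2] [g1 /f2 g2]; split => //.
  by rewrite -[0]addr0 -{1}f1 -g1 -phiD; apply: ext => x; rewrite /= linearD.
- move=> c f [f1 /(h3 c) f2]; split => //.
  by rewrite -(scaler0 _ c) -f1 -phiZ; apply: ext => x; rewrite /= comp_kscale.
- move=> f g fg [f1 /(h4 _ _ fg) f2]; split => //.
  by rewrite -f1; apply: ext => x /=; rewrite fg.
Qed.

(** As in linear algebra, a form vanishing on the common kernel of finitely many forms is a
    combination of them; a combination of translates of [phi] is again a translate. *)
Lemma joint_kernel_form (phi : endo -> E) (l : seq endo) : ideal_form phi ->
  forall psi, ideal_form psi -> (forall f, joint_kernel phi l f -> psi f = 0) ->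
  exists u : endo, forall f, psi f = phi (u \o f).
Proof.
move=> hphi; have [ext phiD phiZ phim] := hphi.
have [mext m0 mD ml mr] := hm.
elim: l => [|u l IH] psi hpsi /= H.
  exists \0 => f; rewrite H // phim //.
  by apply: mext m0.
(* If the translate by [u] vanishes on the remaining kernel it is redundant; otherwise [f1] is a
   pivot for eliminating it from [psi]. *)
have [[f1 Kf1 e0]|no] := EM (exists2 f1, joint_kernel phi l f1 & phi (u \o f1) <> 0);
  last first.
  apply: IH => // f Kf; apply: H; split => //.
  by apply: contrapT => nf; apply: no; exists f.
have [a aE] := hull_socle hE scalar_ideal_maximal e0
  (fun c => @ideal_form_socle phi _ c hphi) (fun c => @ideal_form_socle psi f1 c hpsi).
have hKl := joint_kernel_submodule l hphi; have [_ KlD KlZ _] := hKl.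
have [pext psiD psiZ psim] := hpsi.
have [||v vE] := IH (fun f => psi f - a *: phi (u \o f)).
- split.
  + by move=> f g fg; rewrite (pext _ _ fg) (ext (u \o f) (u \o g)) // => x /=; rewrite fg.
  + move=> f g; rewrite psiD (ext (u \o (f \+ g)) ((u \o f) \+ (u \o g))) => [|x /=].
      by rewrite phiD scalerDr opprD addrACA.
    by rewrite linearD.
  + move=> c f; rewrite psiZ (ext (u \o kscale c f) (kscale c (u \o f))) => [|x /=].
      by rewrite phiZ scalerA mulrC -scalerA scalerBr.
    by rewrite comp_kscale.
  + by move=> f mf; rewrite psim // phim ?scaler0 ?subr0 //; apply: ml.
- move=> f Kf.
  have [c cE] := hull_socle hE scalar_ideal_maximal e0
    (fun c => @ideal_form_socle phi _ c hphi)
    (fun c => @ideal_form_socle phi (u \o f) c hphi).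
  (* [c] is chosen so that [f - c f1] is also killed by the translate by [u]. *)
  have : psi (f \+ kscale (- c) f1) = 0.
    apply: H; split; last by apply: KlD => //; apply: KlZ.
    rewrite (ext _ ((u \o f) \+ kscale (- c) (u \o f1))) => [|x /=].
      by rewrite phiD phiZ cE scaleNr subrr.
    by rewrite linearD comp_kscale.
  by rewrite psiD psiZ aE cE scaleNr => /eqP; rewrite !scalerA mulrC => /eqP.
exists (v \+ kscale a u) => f.
rewrite (ext _ ((v \o f) \+ kscale a (u \o f))) => [|x //].
by rewrite phiD phiZ -vE subrK.
Qed.

(* The End-submodule of the dual of End / m generated by phi separates points,
   so it is the whole dual. *)
Lemma ideal_form_generates (phi psi : endo -> E) : ideal_form phi ->
  (exists f, phi f <> 0) -> ideal_form psi ->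
  exists u : endo, forall f, psi f = phi (u \o f).
Proof.
move=> hphi [f0 f0n] hpsi; have [ext phiD phiZ phim] := hphi.
have [||S [[l SE] Smin]] := end_dcc_min hR fgM
  (F := fun S => exists l, S = joint_kernel phi l).
- by move=> S [l ->]; apply: joint_kernel_submodule.
- by exists (joint_kernel phi [::]), [::].
rewrite {S}SE in Smin; apply: (joint_kernel_form hphi (l := l)) => // f Kf.
(* An invertible [f] in the minimal joint kernel would, on adding the translate by [f0 g] with [g]
   inverse to [f], satisfy [phi f0 = 0]. So this kernel lies in [m], where [psi] vanishes. *)
have [_ _ _ psim] := hpsi; apply/psim/maximal_ideal_bij => /lin_inverse[g [gK _]].
have [||] := Smin (joint_kernel phi ((f0 \o g : endo) :: l)) _ _ f Kf.
- by exists ((f0 \o g : endo) :: l).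
- by move=> h [].
move=> H _; apply: f0n; rewrite -H; apply: ext => x /=.
by rewrite gK.
Qed.

End LocalEndomorphisms.

(** * Chain maps up to homotopy *)

(** Homotopy conditions are stated in degrees [i + 1]; every integer has this form. *)
Lemma int_succ_ind (P : int -> Prop) : (forall i, P (i + 1)) -> forall i, P i.
Proof. by move=> H i; rewrite -(subrK 1 i). Qed.

Section Homotopy.
Variable R : pzRingType.
Implicit Types X Y Z W : complex R.

Lemma homotopic_ext X Y (f g : chmap X Y) :
  (forall i x, f (i + 1) x = g (i + 1) x) -> homotopic f g.
Proof.
by move=> fg; exists (fun _ => \0) => i x; rewrite fg subrr linear0 addr0.
Qed.

Lemma homotopic_refl X Y (f : chmap X Y) : homotopic f f.
Proof. exact: homotopic_ext. Qed.

Lemma homotopic_sym X Y (f g : chmap X Y) : homotopic f g -> homotopic g f.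
Proof.
move=> [h hE]; exists (fun i => \- h i) => i x.
by rewrite -opprB hE opprD /= linearN.
Qed.

Lemma homotopic_trans X Y (g f h : chmap X Y) :
  homotopic f g -> homotopic g h -> homotopic f h.
Proof.
move=> [s sE] [t tE]; exists (fun i => s i \+ t i) => i x.
by rewrite -[f _ x](subrK (g (i + 1) x)) -addrA sE tE /= linearD addrACA.
Qed.

Lemma homotopic_comp X Y Z (g g' : chmap Y Z) (f f' : chmap X Y) :
  homotopic g g' -> homotopic f f' -> homotopic (chcomp g f) (chcomp g' f').
Proof.
move=> [s sE] [t tE].
exists (fun i => (s i \o f (i + 1)) \+ (g' i \o t i)) => i x /=.
rewrite -[g _ _](subrK (g' (i + 1) (f (i + 1) x))) -addrA -linearB sE tE.
by rewrite !linearD /= !cmapE addrACA.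
Qed.

Fact chsub_subproof X Y (f g : chmap X Y) (i : int) (x : X i) :
  (f (i + 1) \- g (i + 1)) (cdiff X i x) = cdiff Y i ((f i \- g i) x).
Proof. by rewrite /= linearB !cmapE. Qed.

Definition chsub X Y (f g : chmap X Y) : chmap X Y :=
  @ChMap R X Y (fun i => f i \- g i) (chsub_subproof f g).

Lemma homotopic_sub0 X Y (f g : chmap X Y) :
  homotopic f g <-> homotopic (chsub f g) (chzero X Y).
Proof. by split=> -[h hE]; exists h => i x; rewrite -hE /= subr0. Qed.

Lemma homotopic0P X Y (f : chmap X Y) : homotopic f (chzero X Y) <->
  exists h : forall i : int, {linear X (i + 1) -> Y i},
    forall (i : int) (x : X (i + 1)),
      f (i + 1) x = cdiff Y i (h i x) + h (i + 1) (cdiff X (i + 1) x).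
Proof. by split=> -[h hE]; exists h => i x; rewrite -hE /= subr0. Qed.

Lemma chcomp0 X Y Z (g : chmap Y Z) :
  homotopic (chcomp g (chzero X Y)) (chzero X Z).
Proof. by apply: homotopic_ext => i x; rewrite /= linear0. Qed.

Lemma ch0comp X Y Z (f : chmap X Y) :
  homotopic (chcomp (chzero Y Z) f) (chzero X Z).
Proof. exact: homotopic_ext. Qed.

Lemma chcompA X Y Z W (h : chmap Z W) (g : chmap Y Z) (f : chmap X Y) :
  homotopic (chcomp h (chcomp g f)) (chcomp (chcomp h g) f).
Proof. exact: homotopic_ext. Qed.

Lemma chcompl X Y Z (g g' : chmap Y Z) (f : chmap X Y) :
  homotopic g g' -> homotopic (chcomp g f) (chcomp g' f).
Proof. by move=> H; apply: homotopic_comp => //; apply: homotopic_refl. Qed.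

Lemma chcompr X Y Z (g : chmap Y Z) (f f' : chmap X Y) :
  homotopic f f' -> homotopic (chcomp g f) (chcomp g f').
Proof. by move=> H; apply: homotopic_comp => //; apply: homotopic_refl. Qed.

Lemma chsub_compr X Y Z (g g' : chmap Y Z) (f : chmap X Y) :
  homotopic (chcomp (chsub g g') f) (chsub (chcomp g f) (chcomp g' f)).
Proof. exact: homotopic_ext. Qed.

Lemma chcomp_null_l X Y Z (g : chmap Y Z) (f : chmap X Y) :
  homotopic g (chzero Y Z) -> homotopic (chcomp g f) (chzero X Z).
Proof. by move=> H; apply: homotopic_trans (chcompl f H) (ch0comp _ _). Qed.

Lemma chcomp_null_r X Y Z (g : chmap Y Z) (f : chmap X Y) :
  homotopic f (chzero X Y) -> homotopic (chcomp g f) (chzero X Z).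
Proof. by move=> H; apply: homotopic_trans (chcompr g H) (chcomp0 _ _). Qed.

Section Successor.
Variables (X Y : complex R) (F : forall i : int, {linear X (i + 1) -> Y (i + 1)}).

(** Formulas built from homotopies give maps in degrees [i + 1] only; transport along
    [i - 1 + 1 = i] covers all degrees, and [at_succE] removes it again. *)
Definition at_succ (i : int) : {linear X i -> Y i} :=
  eq_rect _ (fun j => {linear X j -> Y j}) (F (i - 1)) _ (subrK 1 i).

Lemma at_succE i x : at_succ (i + 1) x = F i x.
Proof.
rewrite /at_succ; move: (subrK 1 (i + 1)).
have : i + 1 - 1 = i by rewrite addrK.
by move: (i + 1 - 1) => j -> e; rewrite eq_axiomK.
Qed.

Lemma chmap_at_succ : (forall i x, F (i + 1) (cdiff X (i + 1) x) = cdiff Y (i + 1) (F i x)) ->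
  exists f : chmap X Y, forall i x, f (i + 1) x = F i x.
Proof.
move=> FE; have chain i x : at_succ (i + 1) (cdiff X i x) = cdiff Y i (at_succ i x).
  by move: i x; apply: int_succ_ind => i x; rewrite !at_succE.
by exists (ChMap chain) => i x; apply: at_succE.
Qed.

End Successor.

(** Makes a homotopy correction strict, so that a map can be arranged to vanish exactly in chosen
    degrees. *)
Lemma chmap_sub_boundary X Y (f : chmap X Y) (h : forall i : int, {linear X (i + 1) -> Y i}) :
  exists g : chmap X Y, homotopic f g /\ forall i x,
    g (i + 1) x = f (i + 1) x - (cdiff Y i (h i x) + h (i + 1) (cdiff X (i + 1) x)).
Proof.
pose F i : {linear X (i + 1) -> Y (i + 1)} :=
  f (i + 1) \- ((cdiff Y i \o h i) \+ (h (i + 1) \o cdiff X (i + 1))).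
have [|g gE] := @chmap_at_succ X Y F.
  move=> i x; rewrite /F /= !cdiffK linear0 addr0 linearB linearD.
  by rewrite cdiffK add0r cmapE.
exists g; split => //; exists h => i x; rewrite gE /F /=.
by rewrite opprB [LHS]addrC subrK.
Qed.

(** * Transport between degrees and the inverse shift *)

Section Cast.
Variable X : complex R.

Definition ccast (i j : int) (e : i = j) : {linear X i -> X j} :=
  eq_rect i (fun j => {linear X i -> X j}) idfun j e.

Lemma ccast_id i (e : i = i) x : ccast e x = x.
Proof. by rewrite eq_axiomK. Qed.

Lemma ccastK i j (e : i = j) (e' : j = i) x : ccast e' (ccast e x) = x.
Proof. by case: j / e e' => e'; rewrite !ccast_id. Qed.

Lemma cdiff_ccast i j (e : i = j) (e' : i + 1 = j + 1) x :
  cdiff X j (ccast e x) = ccast e' (cdiff X i x).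
Proof. by case: j / e e' => e'; rewrite !ccast_id. Qed.

Fact unshift_eq (i : int) : i - 1 + 1 = i + 1 - 1. Proof. by rewrite addrAC. Qed.

Definition unshift_diff (i : int) : {linear X (i - 1) -> X (i + 1 - 1)} :=
  \- (ccast (unshift_eq i) \o cdiff X (i - 1)).

Fact unshift_subproof i (x : X (i - 1)) : unshift_diff (i + 1) (unshift_diff i x) = 0.
Proof.
rewrite /unshift_diff /= linearN linearN opprK.
have e' : i - 1 + 1 + 1 = i + 1 - 1 + 1 by rewrite unshift_eq.
by rewrite (cdiff_ccast _ e') cdiffK !linear0.
Qed.

(* X[-1] *)
Definition unshift : complex R := Complex unshift_subproof.

Fact to_unshift_eq (i : int) : i = i + 1 - 1. Proof. by rewrite addrK. Qed.

Definition to_unshift i : {linear X i -> unshift (i + 1)} := ccast (to_unshift_eq i).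

Lemma to_unshift_diff i x :
  cdiff unshift (i + 1) (to_unshift i x) = - to_unshift (i + 1) (cdiff X i x).
Proof.
rewrite /to_unshift /= /unshift_diff /=; congr (- _).
have e' : i + 1 = i + 1 - 1 + 1 by rewrite addrK.
rewrite (cdiff_ccast _ e'); move: (cdiff X i x) => y.
by move: (unshift_eq _) (to_unshift_eq _); case: _ / e' => e1 e2; rewrite ccast_id (eq_irrelevance e1 e2).
Qed.

Fact from_unshift_subproof i (x : shift unshift i) :
  ccast (esym (to_unshift_eq (i + 1))) (cdiff (shift unshift) i x)
    = cdiff X i (ccast (esym (to_unshift_eq i)) x).
Proof.
rewrite -[x](ccastK (esym (to_unshift_eq i)) (to_unshift_eq i)).
set y := ccast _ x; rewrite ccastK.
rewrite -[cdiff (shift unshift) i _]/(- cdiff unshift (i + 1) (to_unshift i y)).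
by rewrite to_unshift_diff opprK ccastK.
Qed.

Definition from_unshift : chmap (shift unshift) X :=
  @ChMap R (shift unshift) X (fun i => ccast (esym (to_unshift_eq i))) from_unshift_subproof.

End Cast.

(** [Tge0] tests only complexes of the form [shift Y]; this reaches any source, by X = X[-1][1]. *)
Lemma null_from_unshift X Y (f : chmap X Y) :
  homotopic (chcomp f (from_unshift X)) (chzero _ Y) -> homotopic f (chzero X Y).
Proof.
have chain i (x : X i) : to_unshift X (i + 1) (cdiff X i x)
    = cdiff (shift (unshift X)) i (to_unshift X i x).
  by rewrite -[RHS]/(- cdiff (unshift X) (i + 1) (to_unshift X i x)) to_unshift_diff opprK.
pose g : chmap X (shift (unshift X)) := @ChMap R X (shift (unshift X)) (fun i => to_unshift X i) chain.
move=> H; apply: homotopic_trans (chcomp_null_l g H).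
by apply: homotopic_ext => i x /=; rewrite ccastK.
Qed.

(** * Complexes cut out by degreewise idempotents *)

Section Split.
Variables (X : complex R) (e : forall i : int, {linear X i -> X i}).
Hypotheses (ee : forall i x, e i (e i x) = e i x)
  (ede : forall i x, e (i + 1 + 1) (cdiff X (i + 1) (e (i + 1) (cdiff X i (e i x)))) = 0).

Fact split_submodule i : submodule (fun x => e i x = x).
Proof.
split=> [|x y Ex Ey|a x Ex]; first exact: linear0.
  by rewrite linearD Ex Ey.
by rewrite linearZ Ex.
Qed.

Definition split_term i : lmodType R := subm (split_submodule i).
Definition split_incl i : {linear split_term i -> X i} := subm_incl (split_submodule i).
Definition split_proj i : {linear X i -> split_term i} :=
  subm_lift (split_submodule i) (@ee i).

Lemma split_inclK i y : split_proj i (split_incl i y) = y.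
Proof. by apply: val_inj => /=; apply: (submP y). Qed.

Lemma split_projE i x : split_incl i (split_proj i x) = e i x.
Proof. by []. Qed.

Lemma split_inclE i y : e i (split_incl i y) = split_incl i y.
Proof. by rewrite -split_projE split_inclK. Qed.

Definition split_diff i : {linear split_term i -> split_term (i + 1)} :=
  split_proj (i + 1) \o (cdiff X i \o split_incl i).

Fact split_subproof i y : split_diff (i + 1) (split_diff i y) = 0.
Proof.
rewrite /split_diff -[y]split_inclK; apply: val_inj.
by rewrite -[LHS]/(e _ (cdiff _ _ (e _ (cdiff _ _ (e i (split_incl i y)))))) ede.
Qed.

(** Covers both brutal truncations, where [e] need not commute with the differential, and summands
    split off by idempotent chain maps. The terms are direct summands of those of [X], so Karoubi
    closedness keeps them in C. *)
Definition split_complex : complex R := Complex split_subproof.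

Lemma split_diffE i y :
  cdiff split_complex i y = split_proj (i + 1) (cdiff X i (split_incl i y)).
Proof. by []. Qed.

Lemma split_zero i : is_zero_module (X i) -> is_zero_module (split_complex i).
Proof. by move=> X0 y; rewrite -[y]split_inclK [split_incl i y]X0 linear0. Qed.

Lemma split_zero_idem i : (forall x, e i x = 0) -> is_zero_module (split_complex i).
Proof. by move=> e0 y; rewrite -[y]split_inclK -[split_incl i y]split_inclE e0 linear0. Qed.

End Split.

Section Brutal.
Variables (X : complex R) (b : int -> bool).
Hypothesis hb : forall i, b i -> b (i + 1 + 1) -> b (i + 1).

Definition brutal_idem i : {linear X i -> X i} := if b i then (idfun : {linear X i -> X i}) else \0.

Lemma brutal_idemT i x : b i -> brutal_idem i x = x.
Proof. by rewrite /brutal_idem => ->. Qed.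
Lemma brutal_idemF i x : b i = false -> brutal_idem i x = 0.
Proof. by rewrite /brutal_idem => ->. Qed.

Fact brutal_idemK i x : brutal_idem i (brutal_idem i x) = brutal_idem i x.
Proof. by rewrite /brutal_idem; case: (b i). Qed.

Fact brutal_ede i x : brutal_idem (i + 1 + 1)
  (cdiff X (i + 1) (brutal_idem (i + 1) (cdiff X i (brutal_idem i x)))) = 0.
Proof.
have [bi|/negPf bi] := boolP (b i); last by rewrite (brutal_idemF _ bi) !linear0.
have [bi2|/negPf bi2] := boolP (b (i + 1 + 1)); last by rewrite (brutal_idemF _ bi2).
by rewrite (brutal_idemT _ bi) (brutal_idemT (cdiff X i x) (hb bi bi2)) cdiffK linear0.
Qed.

(** [hb] forbids gaps of length one in the set of kept degrees, so that the square of the induced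
    differential is zero. *)
Definition brutal : complex R := split_complex brutal_idemK brutal_ede.

End Brutal.

End Homotopy.

(** * Maps out of stalk complexes *)

Section StalkMaps.
Variable R : pzRingType.
Implicit Types X Y Z W : complex R.
Implicit Types M N : lmodType R.

Lemma stalk_zero M (i : int) : i <> 0 -> is_zero_module (stalk M i).
Proof. by case: i => [[//|n]|n] _ x; apply: thinmx0. Qed.

Lemma stalk_diff M (i : int) (x : stalk M i) : cdiff (stalk M) i x = 0.
Proof. by []. Qed.

Section StalkMap.
Variables (M : lmodType R) (X : complex R) (b : {linear M -> X 0}).
Hypothesis db : forall x, cdiff X 0 (b x) = 0.

Definition stalk_map_term (i : int) : {linear stalk M i -> X i} :=
  match i return {linear stalk M i -> X i} with Posz 0 => b | _ => \0 end.

Fact stalk_map_subproof i (x : stalk M i) :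
  stalk_map_term (i + 1) (cdiff (stalk M) i x) = cdiff X i (stalk_map_term i x).
Proof.
rewrite stalk_diff linear0.
by case: i x => [[|n]|n] x /=; rewrite ?linear0 ?db.
Qed.

Definition stalk_map : chmap (stalk M) X :=
  @ChMap R (stalk M) X stalk_map_term stalk_map_subproof.

End StalkMap.

Lemma stalk_map_closed M X (c : chmap (stalk M) X) (x : M) :
  cdiff X 0 (c 0 x) = 0.
Proof. by rewrite -(cmapE c (i := 0) x) linear0. Qed.

(** Degree -1 is written [Negz 0] because [Negz 0 + 1] reduces to [0], so the differential lands in
    [X 0] without a cast. *)
Lemma stalk_homotopicP M X (c c' : chmap (stalk M) X) : homotopic c c' <->
  exists k : {linear M -> X (Negz 0)}, forall x : M, c 0 x - c' 0 x = cdiff X (Negz 0) (k x).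
Proof.
split=> [[h hE]|[k kE]].
  exists (h (Negz 0)) => x; have := hE (Negz 0) x.
  by rewrite stalk_diff linear0 addr0.
exists (fun i => match i return {linear stalk M (i + 1) -> X i} with
  | Negz 0 => k | _ => \0 end) => i x.
rewrite stalk_diff linear0 addr0.
case: i x => [n|[|n]] x; last 1 first.
- by have -> : x = 0 by [apply: stalk_zero]; rewrite !linear0 addr0.
- by have -> : x = 0 by [apply: stalk_zero; lia]; rewrite !linear0 addr0.
- exact: kE.
Qed.

Lemma stalk_null M X (c : chmap (stalk M) X) : homotopic c (chzero _ X) <->
  exists k : {linear M -> X (Negz 0)}, forall x : M, c 0 x = cdiff X (Negz 0) (k x).
Proof.
rewrite stalk_homotopicP; split=> -[k kE]; exists k => x; rewrite -kE.
  by rewrite [chzero _ _ _ _]/(0 : X 0) subr0.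
by rewrite [chzero _ _ _ _]/(0 : X 0) subr0.
Qed.

Lemma stalk_ext M X (c c' : chmap (stalk M) X) :
  (forall x : M, c 0 x = c' 0 x) -> homotopic c c'.
Proof.
move=> cc'; apply/stalk_homotopicP; exists \0 => x; rewrite [RHS]linear0 cc'.
exact: subrr.
Qed.

Fact stalk_lin_subproof M N (f : {linear M -> N}) (x : M) :
  cdiff (stalk N) 0 ((f : {linear M -> stalk N 0}) x) = 0.
Proof. by []. Qed.

Definition stalk_lin M N (f : {linear M -> N}) : chmap (stalk M) (stalk N) :=
  stalk_map (b := (f : {linear M -> stalk N 0})) (stalk_lin_subproof f).

End StalkMaps.

(** * Truncations and maps into T_C^{>=0} *)

Section TStructure.
Variables (R : pzRingType) (CC : lmodType R -> Prop).
Hypothesis hCC : karoubi_subcategory CC.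
Implicit Types X Y Z W : complex R.

Lemma split_Kminus X (e : forall i : int, {linear X i -> X i}) ee ede :
  Kminus CC X -> Kminus CC (@split_complex R X e ee ede).
Proof.
case: hCC => Cfg _ _ _ Ckar [CX [n n0]]; split; last first.
  by exists n => i /n0; apply: split_zero.
move=> i; apply: (Ckar _ _ (split_incl e i) (split_proj ee i)) (CX i) _ _.
  apply: (fg_surj (f := split_proj ee i)) (Cfg _ (CX i)) => y.
  by exists (split_incl e i y); apply: split_inclK.
by move=> y; apply: split_inclK.
Qed.

Lemma unshift_Kminus X : Kminus CC X -> Kminus CC (unshift X).
Proof.
move=> [CX [n n0]]; split; first by move=> i; apply: CX.
by exists (n + 1) => i ni; apply: n0; lia.
Qed.

Lemma isomorphic_refl X : isomorphic X X.
Proof. by exists (chid X), (chid X); split; apply: homotopic_ext. Qed.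

Lemma Tle0_neg X : Kminus CC X -> (forall i, 0 < i -> is_zero_module (X i)) ->
  Tle0 CC X.
Proof. by move=> KX X0; split => //; exists X; split => //; apply: isomorphic_refl. Qed.

Lemma Tge0_null W Y (f : chmap W Y) : Kminus CC W ->
  (forall i, 0 <= i -> is_zero_module (W i)) -> Tge0 CC Y -> homotopic f (chzero W Y).
Proof.
move=> KW W0 [_ Y0]; apply: null_from_unshift; apply: Y0.
apply: Tle0_neg; first exact: unshift_Kminus.
by move=> i i0; apply: W0; lia.
Qed.

Fact trunc_hb (n i : int) : i <= n -> i + 1 + 1 <= n -> i + 1 <= n.
Proof. by lia. Qed.

Definition trunc_le (n : int) X : complex R := brutal X (@trunc_hb n).

Lemma trunc_le_Kminus n X : Kminus CC X -> Kminus CC (trunc_le n X).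
Proof. exact: split_Kminus. Qed.

Lemma trunc_le_zero n X i : n < i -> is_zero_module (trunc_le n X i).
Proof. by move=> ni; apply: split_zero_idem => x; apply: brutal_idemF; lia. Qed.

Definition trunc_incl n X i : {linear trunc_le n X i -> X i} :=
  split_incl (brutal_idem X (fun i => i <= n)) i.
Definition trunc_proj n X i : {linear X i -> trunc_le n X i} :=
  split_proj (@brutal_idemK _ X (fun i => i <= n)) i.

Lemma trunc_diffE n X i y :
  cdiff (trunc_le n X) i y = trunc_proj n X (i + 1) (cdiff X i (trunc_incl n X i y)).
Proof. by []. Qed.

Lemma trunc_projK n X i x : i <= n -> trunc_incl n X i (trunc_proj n X i x) = x.
Proof. by move=> hi; rewrite /trunc_incl /trunc_proj split_projE brutal_idemT. Qed.

Lemma trunc_incl_diff n X i x : i + 1 <= n ->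
  trunc_incl n X (i + 1) (cdiff (trunc_le n X) i x) = cdiff X i (trunc_incl n X i x).
Proof. by move=> hi; rewrite trunc_diffE trunc_projK. Qed.

Lemma trunc_proj_diff n X i x : i <= n ->
  cdiff (trunc_le n X) i (trunc_proj n X i x) = trunc_proj n X (i + 1) (cdiff X i x).
Proof. by move=> hi; rewrite trunc_diffE trunc_projK. Qed.

(* Once killed on X^0, the map factors through the truncation of X in degrees <= -1. *)
Lemma null_of_degree0 X Y (a : chmap X Y) (k : {linear X 0 -> Y (Negz 0)}) :
  Kminus CC X -> (forall i, 0 < i -> is_zero_module (X i)) -> Tge0 CC Y ->
  (forall x, a 0 x = cdiff Y (Negz 0) (k x)) -> homotopic a (chzero X Y).
Proof.
move=> KX X0 gY ak.
(* Subtracting the boundary of this homotopy makes the map vanish in degree 0. *)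
pose h i := match i return {linear X (i + 1) -> Y i} with Negz 0 => k | _ => \0 end.
have [a' [aa' a'E]] := chmap_sub_boundary a h.
apply: homotopic_trans aa' _.
have a'0 (x : X 0) : a' 0 x = 0.
  have -> : a' 0 x = a 0 x - (cdiff Y (Negz 0) (k x) + 0) := a'E (Negz 0) x.
  by rewrite -ak [a 0 x + 0]addr0 [LHS]subrr.
have a'nn i (x : X i) : -1 < i -> a' i x = 0.
  move=> i0; have [ei|/eqP i1] := eqVneq i 0; first by subst i.
  by rewrite [x]X0 ?linear0 //; lia.
have chain i (x : trunc_le (-1) X i) :
    (a' (i + 1) \o trunc_incl (-1) X (i + 1)) (cdiff (trunc_le (-1) X) i x)
    = cdiff Y i ((a' i \o trunc_incl (-1) X i) x).
  rewrite -[LHS]/(a' _ (trunc_incl (-1) X (i + 1) _)).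
  rewrite -[RHS]/(cdiff Y i (a' i (trunc_incl (-1) X i x))) -cmapE.
  have [i1|i1] := boolP (i + 1 <= -1); first by rewrite trunc_incl_diff.
  by rewrite !a'nn //; lia.
pose f : chmap (trunc_le (-1) X) Y :=
  @ChMap R (trunc_le (-1) X) Y (fun i => a' i \o trunc_incl (-1) X i) chain.
have /homotopic0P[s sE] : homotopic f (chzero _ _).
  apply: Tge0_null => //; first exact: trunc_le_Kminus.
  by move=> i i0; apply: trunc_le_zero; lia.
apply/homotopic0P; exists (fun i => s i \o trunc_proj (-1) X (i + 1)) => i x.
rewrite -[RHS]/(cdiff Y i (s i (trunc_proj (-1) X _ x)) +
   s (i + 1) (trunc_proj (-1) X _ (cdiff X (i + 1) x))).
have [i1|i1] := boolP (i + 1 <= -1).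
  rewrite -trunc_proj_diff // -sE -[RHS]/(a' _ (trunc_incl (-1) X _ _)).
  by rewrite trunc_projK.
rewrite a'nn; last by lia.
rewrite [trunc_proj _ _ _ x]trunc_le_zero; last by lia.
by rewrite [trunc_proj _ _ _ _]trunc_le_zero ?linear0 ?addr0 //; lia.
Qed.

(* The map in degree -2 is the homotopy killing g1 d, viewed as a map to Y from
   the truncation of X in degrees <= -2 moved up by one. *)
Lemma extend_degree0 X Y (g0 : {linear X 0 -> Y 0}) (g1 : {linear X (Negz 0) -> Y (Negz 0)}) :
  Kminus CC X -> (forall i, 0 < i -> is_zero_module (X i)) -> Tge0 CC Y ->
  (forall x, cdiff Y 0 (g0 x) = 0) ->
  (forall x, g0 (cdiff X (Negz 0) x) = cdiff Y (Negz 0) (g1 x)) ->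
  exists g : chmap X Y, forall x, g 0 x = g0 x.
Proof.
move=> KX X0 gY dg0 dg1.
have dd i (x : X i) : cdiff X (i + 1) (cdiff X i x) = 0 := cdiffK x.
pose W := trunc_le (Negz 1) X.
pose inc i : {linear W i -> X i} := trunc_incl (Negz 1) X i.
pose prj i : {linear X i -> W i} := trunc_proj (Negz 1) X i.
(* The term of W[-1] in degree -1 is [W (Negz 1)]; [g1 d] placed there is a chain map because
   [d g1 d = g0 d d = 0]. *)
pose f i : {linear unshift W i -> Y i} :=
  match i return {linear unshift W i -> Y i} with
  | Negz 0 => g1 \o (cdiff X (Negz 1) \o inc (Negz 1)) | _ => \0 end.
have chain i (x : unshift W i) : f (i + 1) (cdiff (unshift W) i x) = cdiff Y i (f i x).
  case: i x => [[|n]|[|[|n]]] x; rewrite ?[RHS]linear0 //.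
  - rewrite -[LHS]/(0 : Y 0) -[RHS]/(cdiff Y (Negz 0) (g1 (cdiff X (Negz 1) (inc _ x)))).
    by rewrite -dg1 (dd (Negz 1)) linear0.
  - rewrite -[LHS]/(g1 (cdiff X (Negz 1) (inc (Negz 1) (cdiff (unshift W) (Negz 1) x)))).
    have -> : cdiff (unshift W) (Negz 1) x = - cdiff W (Negz 2) x.
      by rewrite -[LHS]/(- ccast _ (unshift_eq (Negz 1)) _) ccast_id.
    rewrite (linearN (inc (Negz 1))) (linearN (cdiff X (Negz 1))).
    have -> : inc (Negz 1) (cdiff W (Negz 2) x) = cdiff X (Negz 2) (inc (Negz 2) x).
      by exact: (@trunc_incl_diff (Negz 1) X (Negz 2) x).
    by rewrite (dd (Negz 2)) oppr0 linear0.
have /homotopic0P[s sE] : homotopic (@ChMap R (unshift W) Y f chain) (chzero _ _).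
  apply: Tge0_null => //; first exact/unshift_Kminus/trunc_le_Kminus.
  by move=> i i0; apply: trunc_le_zero; lia.
(* The null-homotopy [s] supplies all components in degrees <= -2; the sign in the differential of
   W[-1] turns its equation into the chain condition. *)
pose g i : {linear X i -> Y i} := match i return {linear X i -> Y i} with
  | Posz 0 => g0 | Posz _.+1 => \0 | Negz 0 => g1
  | Negz n.+1 => s (Negz n.+1) \o (to_unshift W (Negz n.+1) \o prj (Negz n.+1)) end.
have chg i (x : X i) : g (i + 1) (cdiff X i x) = cdiff Y i (g i x).
  case: i x => [[|n]|[|[|n]]] x.
  - by rewrite /g /= dg0.
  - by rewrite [x]X0 ?linear0.
  - exact: dg1.
  - set y := to_unshift W (Negz 1) (prj (Negz 1) x); have := sE (Negz 1) y.
    have -> : cdiff (unshift W) (Negz 1 + 1) y = 0.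
      by rewrite to_unshift_diff [cdiff W _ _]trunc_le_zero // linear0 oppr0.
    rewrite linear0 => E; rewrite -[RHS]/(cdiff Y (Negz 1) (s (Negz 1) y)).
    rewrite -[cdiff Y _ _]addr0 -[RHS]E.
    rewrite -[RHS]/(g1 (cdiff X (Negz 1) (inc (Negz 1) y))) /y /to_unshift ccast_id.
    by rewrite [inc _ _]trunc_projK.
  - set y := to_unshift W (Negz n.+2) (prj (Negz n.+2) x).
    rewrite -[RHS]/(cdiff Y (Negz n.+2) (s (Negz n.+2) y)).
    have := sE (Negz n.+2) y; rewrite to_unshift_diff (linearN (s _)).
    rewrite [cdiff W _ _]trunc_proj_diff //.
    by rewrite -[LHS]/(0 : Y _) => /esym/eqP; rewrite subr_eq0 => /eqP ->.
by exists (ChMap chg).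
Qed.

End TStructure.

(** * Objects of the heart *)

Section Heart.
Variables (R : pzRingType) (CC : lmodType R -> Prop).
Hypothesis hCC : karoubi_subcategory CC.
Implicit Types X Y Z W : complex R.

Section DegreeZero.
Variable X : complex R.
Hypothesis X0 : forall i, 0 < i -> is_zero_module (X i).
Fact degree0_closed x : cdiff X 0 ((idfun : {linear X 0 -> X 0}) x) = 0.
Proof. exact: X0. Qed.
Definition degree0_map : chmap (stalk (X 0)) X := stalk_map degree0_closed.
End DegreeZero.

(** For a model [X'] of [X] in degrees <= 0, the single test map from the stalk of [X' 0] suffices,
    by [null_of_degree0]. *)
Lemma null_of_stalks X Y (a : chmap X Y) : Tle0 CC X -> Tge0 CC Y ->
  (forall M, CC M -> forall b : chmap (stalk M) X, homotopic (chcomp a b) (chzero _ Y)) ->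
  homotopic a (chzero X Y).
Proof.
move=> [_ [X' [KX' X'0 [w' [w [w'w ww']]]]]] gY a0.
have : homotopic (chcomp a w) (chzero X' Y).
  have /stalk_null[k kE] := a0 _ (proj1 KX' 0) (chcomp w (degree0_map X'0)).
  exact: (null_of_degree0 hCC (k := k)).
move=> /(chcomp_null_l w') aww'; apply: homotopic_trans aww'.
apply: homotopic_trans (chcompA _ _ _).
by apply: homotopic_sym; apply: (homotopic_trans (chcompr a w'w)); apply: homotopic_ext.
Qed.

Lemma homotopic_of_stalks X Y (a a' : chmap X Y) : Tle0 CC X -> Tge0 CC Y ->
  (forall M, CC M -> forall b : chmap (stalk M) X, homotopic (chcomp a b) (chcomp a' b)) ->
  homotopic a a'.
Proof.
move=> lX gY aa'; apply/homotopic_sub0/null_of_stalks => // M CM b.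
by apply: homotopic_trans (chsub_compr _ _ _) _; apply: (proj1 (homotopic_sub0 _ _)); apply: aa'.
Qed.

(** Since the P_M generate the heart, this is a concrete substitute for being mono; it also applies
    to maps into complexes of H_A whose terms are not in C. *)
Definition stalk_injective X Y (f : chmap X Y) : Prop :=
  forall M, CC M -> forall b b' : chmap (stalk M) X,
    homotopic (chcomp f b) (chcomp f b') -> homotopic b b'.

Definition stalk_surjective X Y (f : chmap X Y) : Prop :=
  forall M, CC M -> forall b : chmap (stalk M) Y,
    exists b', homotopic (chcomp f b') b.

(** Surjectivity lifts the degree 0 part of [t], injectivity makes the lift null on boundaries,
    which provides a degree -1 part, and [extend_degree0] does the rest. *)
Lemma lift_of_stalks X Y Z (f : chmap X Z) (t : chmap Y Z) :
  Tge0 CC X -> Tge0 CC Z -> stalk_injective f -> stalk_surjective f -> Tle0 CC Y ->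
  exists g, homotopic (chcomp f g) t.
Proof.
move=> gX gZ finj fsurj [_ [Y' [KY' Y'0 [w' [w [w'w ww']]]]]].
have [c cE] := fsurj _ (proj1 KY' 0) (chcomp (chcomp t w) (degree0_map Y'0)).
have /stalk_null[k kE] : homotopic (chcomp c (stalk_lin (cdiff Y' (Negz 0)))) (chzero _ X).
  apply: finj; first exact: (proj1 KY' (Negz 0)).
  apply: homotopic_trans (homotopic_sym (chcomp0 _ f)).
  apply: homotopic_trans (chcompA _ _ _) _.
  apply: homotopic_trans (chcompl _ cE) _.
  apply: homotopic_trans (homotopic_sym (chcompA _ _ _)) _.
  by apply: chcomp_null_r; apply/stalk_null; exists idfun.
have [|x|g gE] := @extend_degree0 _ _ hCC Y' X (c 0 : {linear Y' 0 -> X 0}) k KY' Y'0 gX.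
- by move=> x; apply: stalk_map_closed.
- exact: kE.
have fg : homotopic (chcomp f g) (chcomp t w).
  apply/homotopic_sub0; have /stalk_homotopicP[s sE] := cE.
  apply: (null_of_degree0 hCC (k := s)) => // x.
  by rewrite -sE /= gE.
exists (chcomp g w'); apply: homotopic_trans (chcompA _ _ _) _.
apply: homotopic_trans (chcompl _ fg) _.
apply: homotopic_trans (homotopic_sym (chcompA _ _ _)) _.
by apply: homotopic_trans (chcompr t w'w) _; apply: homotopic_ext.
Qed.

Lemma chiso_of_stalks X Y (f : chmap X Y) : heart CC X -> heart CC Y ->
  stalk_injective f -> stalk_surjective f -> chiso f.
Proof.
move=> [lX gX] [lY gY] finj fsurj.
have [g fg] := lift_of_stalks (chid Y) gX gY finj fsurj lY.
exists g; split => //; apply: homotopic_of_stalks => // M CM b; apply: finj => //.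
apply: (homotopic_trans (g := chcomp (chcomp f g) (chcomp f b))); first exact: homotopic_ext.
by apply: homotopic_trans (chcompl _ fg) _; apply: homotopic_ext.
Qed.

Fact chshift_subproof X Y (f : chmap X Y) i (x : shift X i) :
  f (i + 1 + 1) (cdiff (shift X) i x) = cdiff (shift Y) i (f (i + 1) x).
Proof. by rewrite /= linearN cmapE. Qed.

Definition chshift X Y (f : chmap X Y) : chmap (shift X) (shift Y) :=
  @ChMap R (shift X) (shift Y) (fun i => f (i + 1)) (chshift_subproof f).

Lemma chshift_homotopic X Y (f g : chmap X Y) : homotopic f g ->
  homotopic (chshift f) (chshift g).
Proof.
move=> [h hE]; exists (fun i => \- h (i + 1)) => i x.
by rewrite /= !linearN !opprK; apply: hE.
Qed.

Lemma Tge0_criterion X : Kminus CC X ->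
  (forall W (f : chmap W X), Kminus CC W -> (forall i, 0 <= i -> is_zero_module (W i)) ->
     homotopic f (chzero W X)) -> Tge0 CC X.
Proof.
move=> KX H; split => // Y f [_ [Y' [[CY' [n n0]] Y'0 [w' [w [w'w ww']]]]]].
have : homotopic (chcomp f (chshift w)) (chzero _ X).
  apply: H; last by move=> i i0; apply: Y'0; lia.
  split; first by move=> i; apply: CY'.
  by exists n => i ni; apply: n0; lia.
move=> /(chcomp_null_l (chshift w')) H'; apply: homotopic_trans H'.
apply: homotopic_trans (chcompA _ _ _).
apply: homotopic_trans (chcompr f (homotopic_sym (chshift_homotopic w'w))).
exact: homotopic_ext.
Qed.

Lemma stalk_Kminus M : CC M -> Kminus CC (stalk M).
Proof.
move=> CM; split; last by exists 0 => i i0; apply: stalk_zero; lia.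
by have [_ _ C0 _ _] := hCC; case=> [[|n]|n].
Qed.

Lemma stalk_heart M : CC M -> heart CC (stalk M).
Proof.
move=> CM; split.
  by apply: Tle0_neg; [apply: stalk_Kminus | move=> i i0; apply: stalk_zero; lia].
apply: Tge0_criterion; first exact: stalk_Kminus.
move=> W f _ W0; apply: homotopic_ext => i x.
have [i0|i0] := boolP (0 <= i + 1); first by rewrite [x]W0 // !linear0.
by rewrite [LHS]stalk_zero ?[RHS]stalk_zero //; lia.
Qed.

(* The homotopy contracts W onto the image of the injective map d : X^-2 -> X^-1. *)
Lemma heartA_null X W (f : chmap W X) : heartA X ->
  (forall i, 0 <= i -> is_zero_module (W i)) -> homotopic f (chzero W X).
Proof.
move=> [_ X0 Xex] W0.
have inj : injective (cdiff X (Negz 1)).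
  apply: raddf_inj => y /(Xex (Negz 2) y isT)[z ->].
  by rewrite [z]X0 ?linear0 //; left.
have /choice[u uE] : forall x : W (Negz 0), exists y, f (Negz 0) x = cdiff X (Negz 1) y.
  move=> x; apply: (Xex (Negz 1)) => //.
  rewrite -[LHS]/(cdiff X (Negz 0) (f (Negz 0) x)) -cmapE.
  by rewrite [cdiff W _ x]W0 ?linear0.
have u_lin : linear u by move=> a x y; apply: inj; rewrite linearP -!uE linearP.
pose U : {linear W (Negz 0) -> X (Negz 1)} := HB.pack u
  (GRing.isLinear.Build R (W (Negz 0)) (X (Negz 1)) _ u u_lin).
apply/homotopic0P; exists (fun i => match i return {linear W (i + 1) -> X i} with
  | Negz 1 => U | _ => \0 end) => i x.
case: i x => [n|[|[|[|n]]]] x.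
- by have -> : x = 0 by [apply: W0]; rewrite !linear0 addr0.
- by have -> : x = 0 by [apply: W0]; rewrite !linear0 addr0.
- rewrite -[RHS]/(cdiff X (Negz 1) (u x) + 0 : X (Negz 0)) -uE.
  exact/esym/addr0.
- rewrite -[RHS]/(cdiff X (Negz 2) 0 + u (cdiff W (Negz 1) x) : X (Negz 1)).
  apply: inj; rewrite linear0 add0r -uE.
  exact/esym/(cmapE f (i := Negz 1)).
- by rewrite [LHS]X0 1?[RHS]X0 //; left.
Qed.

Section ChainIdempotent.
Variables (X : complex R) (e : chmap X X).
Hypothesis ee : forall i x, e i (e i x) = e i x.

Fact chain_idem_ede i x :
  e (i + 1 + 1) (cdiff X (i + 1) (e (i + 1) (cdiff X i (e i x)))) = 0.
Proof. by rewrite (cmapE e (e i x)) cdiffK linear0. Qed.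

Definition chain_split := split_complex ee chain_idem_ede.

Lemma chain_split_iso : homotopic e (chid X) -> isomorphic X chain_split.
Proof.
move=> e1.
have ci i (y : chain_split i) :
    split_incl (fun i => e i) (i + 1) (cdiff chain_split i y)
    = cdiff X i (split_incl (fun i => e i) i y).
  by rewrite [LHS]split_projE cmapE split_inclE.
have cp i (x : X i) : split_proj ee (i + 1) (cdiff X i x)
    = cdiff chain_split i (split_proj ee i x).
  apply: val_inj; rewrite -[LHS]/(e _ _) -[RHS]/(e _ (cdiff X i (e i x))).
  by rewrite !cmapE ee.
pose p : chmap X chain_split := @ChMap R X chain_split (split_proj ee) cp.
pose j : chmap chain_split X :=
  @ChMap R chain_split X (split_incl (fun i => e i)) ci.
exists p, j; split.
  by apply: homotopic_trans e1; apply: homotopic_ext.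
by apply: homotopic_ext => i y; apply: split_inclK.
Qed.

End ChainIdempotent.

Fact upper_hb (i : int) : 1 <= i -> 1 <= i + 1 + 1 -> 1 <= i + 1.
Proof. by lia. Qed.

(* The inclusion of the part of Z in degrees >= 1 becomes null in X, hence is
   null, and such a null-homotopy splits Z off in degrees >= 1. *)
Lemma approximation_Tle0 X Z (q : chmap Z X) :
  (forall i, 0 < i -> is_zero_module (X i)) -> approximation CC q -> Tle0 CC Z.
Proof.
move=> X0 [KZ _ qbij]; split => //.
pose S := brutal Z upper_hb.
pose inc i : {linear S i -> Z i} := split_incl (brutal_idem Z (fun i => 1 <= i)) i.
pose prj i : {linear Z i -> S i} := split_proj (@brutal_idemK _ Z (fun i => 1 <= i)) i.
have prjK i x : 1 <= i -> inc i (prj i x) = x.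
  by move=> i1; rewrite /inc /prj split_projE brutal_idemT.
have S0 i : i < 1 -> is_zero_module (S i).
  by move=> i1; apply: split_zero_idem => x; apply: brutal_idemF; lia.
have incE i (y : S i) : inc (i + 1) (cdiff S i y) = cdiff Z i (inc i y).
  have [i1|i1] := boolP (1 <= i); last by rewrite [y]S0 ?linear0 //; lia.
  by rewrite split_diffE prjK //; lia.
pose j : chmap S Z := @ChMap R S Z inc incE.
have [h hE] : exists h : forall i : int, {linear S (i + 1) -> Z i},
    forall (i : int) (x : S (i + 1)),
      inc (i + 1) x = cdiff Z i (h i x) + h (i + 1) (cdiff S (i + 1) x).
  apply/(homotopic0P j); apply: (proj1 (qbij S (split_Kminus hCC _ _ KZ))).
  apply: homotopic_ext => i y; rewrite /= linear0.
  have [i1|i1] := boolP (1 <= i + 1); first by rewrite [LHS]X0 //; lia.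
  by rewrite [y]S0 ?linear0 //; lia.
(* [h] extended to [Z] by zero below degree 1; there it contracts the identity of [Z]. *)
pose hp i : {linear Z (i + 1) -> Z i} := h i \o prj (i + 1).
have hp0 i x : i < 0 -> hp i x = 0.
  by move=> i0; rewrite -[LHS]/(h i (prj _ x)) [prj _ x]S0 ?linear0 //; lia.
have hpE i x : 0 <= i -> x = cdiff Z i (hp i x) + hp (i + 1) (cdiff Z (i + 1) x).
  move=> i0; rewrite -[LHS](prjK (i + 1)); last by lia.
  by rewrite hE split_diffE [split_incl _ _ _]prjK //; lia.
have [e [e1 eE]] := chmap_sub_boundary (chid Z) hp.
have {}eE i x : e (i + 1) x
    = x - (cdiff Z i (hp i x) + hp (i + 1) (cdiff Z (i + 1) x)) by exact: eE.
have epos i x : 0 < i -> e i x = 0.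
  move: i x; apply: int_succ_ind => i x i0.
  by rewrite eE -hpE ?subrr //; lia.
(* [e] is the identity in negative degrees. In degree 0 it differs from the identity by [hp d], and
   [d e = e d = 0] because [e] vanishes in degree 1. *)
have ee i x : e i (e i x) = e i x.
  have [i0|i0] := boolP (0 < i); first by rewrite !epos.
  move: i x i0; apply: int_succ_ind => i x i0.
  rewrite [LHS]eE hp0 ?linear0 ?add0r; last by lia.
  have [i1|i1] := boolP (i + 1 < 0); first by rewrite hp0 // subr0.
  by rewrite -cmapE [e _ (cdiff _ _ _)]epos ?linear0 ?addr0 //; lia.
exists (chain_split ee); split.
- exact: split_Kminus.
- by move=> i i0; apply: split_zero_idem => x; apply: epos.
- by apply: chain_split_iso; apply: homotopic_sym.
Qed.

Lemma approximation_heart X Z (q : chmap Z X) :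
  heartA X -> approximation CC q -> heart CC Z.
Proof.
move=> hX aq; have [KZ _ qbij] := aq; split.
  by apply: approximation_Tle0 aq => i i0; have [_ X0 _] := hX; apply: X0; right.
apply: Tge0_criterion => // W f KW W0; apply: (proj1 (qbij W KW)).
apply: homotopic_trans (homotopic_sym (chcomp0 W q)).
exact: heartA_null.
Qed.

End Heart.

(** * Three-term complexes in H_A *)

Section ThreeTerm.
Variables (R : pzRingType) (A B : lmodType R) (phi : {linear A -> B}).

Fact lker_submodule : submodule (fun x => phi x = 0).
Proof.
split=> [|x y Ex Ey|a x Ex]; first exact: linear0.
  by rewrite linearD Ex Ey addr0.
by rewrite linearZ /= Ex scaler0.
Qed.

(** The kernel in degree -2 removes cohomology in degree -1. Maps from P_M to the complex form the
    cokernel of Hom(M, A) -> Hom(M, B), so it presents a functor by [phi]. *)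
Definition three_term (i : int) : lmodType R :=
  match i with
  | Posz 0 => B | Negz 0 => A | Negz 1 => subm lker_submodule | _ => 'rV[R]_0
  end.

Definition three_diff (i : int) : {linear three_term i -> three_term (i + 1)} :=
  match i return {linear three_term i -> three_term (i + 1)} with
  | Negz 0 => phi | Negz 1 => subm_incl lker_submodule | _ => \0
  end.

Fact three_subproof i (x : three_term i) : three_diff (i + 1) (three_diff i x) = 0.
Proof.
case: i x => [n|[|[|n]]] x; rewrite ?linear0 //.
exact: (submP x).
Qed.

(* [ker phi -> A -> B], with B in degree 0. *)
Definition three : complex R := Complex three_subproof.

Lemma three_heartA : finitely_generated A -> finitely_generated B ->
  finitely_generated (subm lker_submodule) -> heartA three.
Proof.
move=> fA fB fK; split.
- by case=> [[|n]|[|[|n]]] //; apply: fg_rV0.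
- by case=> [[|n]|[|[|n]]] H x; first [by case: H | exact: thinmx0].
case=> [n|[|[|n]]] x H xE; [by [] | by [] | |].
- have [y yE] := @subm_surj _ _ _ lker_submodule x xE.
  by exists y; rewrite -yE.
- case: n x H xE => [|n] x H xE; last by exists 0; rewrite linear0; apply: thinmx0.
  by exists 0; rewrite linear0; apply: val_inj.
Qed.

Section MapTo.
Variables (X : complex R) (g0 : {linear X 0 -> B}) (g1 : {linear X (Negz 0) -> A}).
Hypothesis g01 : forall x, phi (g1 x) = g0 (cdiff X (Negz 0) x).

Fact three_map_ker x : phi ((g1 \o cdiff X (Negz 1)) x) = 0.
Proof.
rewrite /= g01.
have -> : cdiff X (Negz 0) (cdiff X (Negz 1) x) = 0 by exact: (cdiffK (i := Negz 1)).
exact: linear0.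
Qed.

Definition three_map_term (i : int) : {linear X i -> three i} :=
  match i return {linear X i -> three i} with
  | Posz 0 => g0 | Negz 0 => g1
  | Negz 1 => subm_lift lker_submodule three_map_ker | _ => \0
  end.

Fact three_map_subproof i (x : X i) :
  three_map_term (i + 1) (cdiff X i x) = cdiff three i (three_map_term i x).
Proof.
case: i x => [[|n]|[|[|[|n]]]] x; rewrite ?[RHS]linear0 //.
apply: val_inj; rewrite -[LHS]/(g1 (cdiff X (Negz 1) (cdiff X (Negz 2) x))).
have -> : cdiff X (Negz 1) (cdiff X (Negz 2) x) = 0 by exact: (cdiffK (i := Negz 2)).
exact: linear0.
Qed.

Definition three_map : chmap X three := @ChMap R X three three_map_term three_map_subproof.

End MapTo.

Definition stalk_three (M : lmodType R) (b : {linear M -> B}) : chmap (stalk M) three :=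
  @stalk_map R M three (b : {linear M -> three 0}) (fun=> erefl).

End ThreeTerm.

(** * Cokernels and images in H_C *)

Section HeartConstructions.
Variables (R : pzRingType) (CC : lmodType R -> Prop).
Hypotheses (hCC : karoubi_subcategory CC) (happ : approximating CC).
Hypothesis noeth : forall (M : lmodType R) (N : M -> Prop) (hN : submodule N),
  finitely_generated M -> finitely_generated (subm hN).
Implicit Types X Y Z W L N : complex R.

Lemma CC_fg M : CC M -> finitely_generated M.
Proof. by case: hCC => + _ _ _ _; apply. Qed.

Lemma heartA_approximation X : heartA X ->
  exists Z (q : chmap Z X), approximation CC q /\ heart CC Z.
Proof.
move=> hX; have [fX X0 _] := hX.
have [|Z [q aq]] := happ (X := X).
  by split => //; exists 0 => i i0; apply: X0; right.
by exists Z, q; split => //; apply: approximation_heart aq.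
Qed.

Lemma approximation_lift X Z (q : chmap Z X) W (t : chmap W X) :
  approximation CC q -> Kminus CC W -> exists t', homotopic (chcomp q t') t.
Proof. by case=> _ _ qbij KW; apply: (proj2 (qbij W KW)). Qed.

Lemma approximation_inj X Z (q : chmap Z X) W (t t' : chmap W Z) :
  approximation CC q -> Kminus CC W ->
  homotopic (chcomp q t) (chcomp q t') -> homotopic t t'.
Proof. by case=> _ _ qbij KW; apply: (proj1 (qbij W KW)). Qed.

(** Maps from stalks see only degrees -1 and 0, so a model of [L] may be cut off to [three phi]. The
    lifting property lets [L] play the role of the approximation of [three phi]. *)
Lemma heart_resolution L : heart CC L ->
  exists (A B : lmodType R) (phi : {linear A -> B}) (z : chmap L (three phi)),
    [/\ finitely_generated A /\ finitely_generated B, heartA (three phi),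
        stalk_injective CC z, stalk_surjective CC z &
        forall N (t : chmap N (three phi)), Tle0 CC N ->
          exists n, homotopic (chcomp z n) t].
Proof.
move=> [lL gL]; have [KL [L' [KL' L'0 [w' [w [w'w ww']]]]]] := lL.
pose phi := cdiff L' (Negz 0).
pose eta : chmap L' (three phi) :=
  @three_map _ _ _ phi L' (idfun : {linear L' 0 -> L' 0}) idfun (fun=> erefl).
pose z := chcomp eta w'.
have fA := CC_fg (proj1 KL' (Negz 0)); have fB := CC_fg (proj1 KL' 0).
have hA : heartA (three phi) by apply: three_heartA => //; apply: noeth.
have zinj : stalk_injective CC z.
  move=> M CM b b' /stalk_homotopicP[k kE].
  have w'b : homotopic (chcomp w' b) (chcomp w' b') by apply/stalk_homotopicP; exists k.
  have ww'1 (c : chmap (stalk M) L) : homotopic (chcomp w (chcomp w' c)) c.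
    apply: homotopic_trans (chcompA _ _ _) _.
    by apply: homotopic_trans (chcompl _ w'w) _; apply: homotopic_ext.
  apply: homotopic_trans (homotopic_sym (ww'1 b)) _.
  exact: homotopic_trans (chcompr w w'b) (ww'1 b').
have zsurj : stalk_surjective CC z.
  move=> M CM b.
  have cl (x : M) : cdiff L' 0 ((b 0 : {linear M -> L' 0}) x) = 0 by apply: L'0.
  exists (chcomp w (stalk_map cl)).
  apply: (homotopic_trans (g := chcomp eta (chcomp (chcomp w' w) (stalk_map cl)))).
    exact: homotopic_ext.
  apply: homotopic_trans (chcompr _ (chcompl _ ww')) _.
  apply/stalk_homotopicP; exists \0 => x; rewrite [RHS]linear0.
  exact: subrr.
exists _, _, phi, z; split => // N t lN.
have [Z [q [aq hZ]]] := heartA_approximation hA.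
have [z' qz'] := approximation_lift z aq KL.
have [t' qt'] := approximation_lift t aq (proj1 lN).
(* The comparison [z'] of [L] with the approximation [Z] is bijective on maps from stalks, hence
   [t'] lifts along it. *)
have [||n nE] := @lift_of_stalks _ _ hCC _ _ _ z' t' gL (proj2 hZ) _ _ lN.
- move=> M CM b b' H; apply: zinj => //.
  apply: homotopic_trans (chcompl b (homotopic_sym qz')) _.
  apply: homotopic_trans (homotopic_sym (chcompA _ _ _)) _.
  apply: homotopic_trans (chcompr q H) _.
  apply: homotopic_trans (chcompA _ _ _) _.
  exact: chcompl.
- move=> M CM b; have [b' b'E] := zsurj M CM (chcomp q b).
  exists b'; apply: (approximation_inj aq (stalk_Kminus hCC CM)).
  apply: homotopic_trans (chcompA _ _ _) _.
  exact: homotopic_trans (chcompl b' qz') b'E.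
exists n; apply: homotopic_trans (chcompl n (homotopic_sym qz')) _.
apply: homotopic_trans (homotopic_sym (chcompA _ _ _)) _.
exact: homotopic_trans (chcompr q nE) qt'.
Qed.

(** Adding [C], mapped by [g], to the relations [A] of a presentation of [Y] presents the cokernel;
    the last clause is exactness at [Y], tested on stalks. *)
Lemma heart_cokernel (C : lmodType R) Y (g : chmap (stalk C) Y) : CC C -> heart CC Y ->
  exists G (c : chmap Y G), [/\ heart CC G, homotopic (chcomp c g) (chzero _ G) &
    forall M, CC M -> forall b : chmap (stalk M) Y, homotopic (chcomp c b) (chzero _ G) ->
      exists b', homotopic (chcomp g b') b].
Proof.
move=> CCC hY; have [A [B [phi [z [[fA fB] hA zinj _ _]]]]] := heart_resolution hY.
pose g0 : {linear C -> B} := chcomp z g 0.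
pose psi : {linear (C * A)%type -> B} := lcopair g0 phi.
have psiE a : psi ((lpair \0 idfun : {linear A -> (C * A)%type}) a) = phi a.
  by rewrite -[LHS]/(g0 0 + phi a) linear0 add0r.
have hB : heartA (three psi).
  by apply: three_heartA => //; [|apply: noeth]; apply: fg_pair => //; apply: CC_fg.
pose kap : chmap (three phi) (three psi) :=
  @three_map _ _ _ psi (three phi) (idfun : {linear B -> B}) (lpair \0 idfun) psiE.
have [G [q [aq hG]]] := heartA_approximation hB.
have [KY _] := hY.1; have [c cE] := approximation_lift (chcomp kap z) aq KY.
have cbE M (b : chmap (stalk M) Y) :
    homotopic (chcomp q (chcomp c b)) (chcomp kap (chcomp z b)).
  apply: homotopic_trans (chcompA _ _ _) _.
  apply: homotopic_trans (chcompl b cE) _.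
  exact: homotopic_sym (chcompA _ _ _).
exists G, c; split => //.
- apply: (approximation_inj aq (stalk_Kminus hCC CCC)).
  apply: homotopic_trans (cbE _ g) _; apply: homotopic_trans (homotopic_sym (chcomp0 _ q)).
  apply/stalk_null; exists (lpair idfun \0) => x.
  by rewrite -[RHS]/(g0 x + phi 0) linear0 addr0.
- move=> M CM b cb0.
  have /stalk_null[k kE] : homotopic (chcomp kap (chcomp z b)) (chzero _ _).
    by apply: homotopic_trans (homotopic_sym (cbE _ b)) _; apply: chcomp_null_r.
  (* The null-homotopy splits: its [C]-part is the lift through [g], its [A]-part the homotopy
     showing that this is a lift of [b]. *)
  pose k1 : {linear M -> C} := @lfst _ C A \o k.
  pose k2 : {linear M -> A} := @lsnd _ C A \o k.
  exists (stalk_lin k1); apply: zinj => //; apply/stalk_homotopicP.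
  exists (\- k2) => x; rewrite -[RHS]/(phi (- k2 x)) linearN.
  rewrite -[_ - _]/(g0 (k1 x) - chcomp kap (chcomp z b) 0 x) kE.
  by rewrite -[cdiff _ _ _]/(g0 (k1 x) + phi (k2 x)) opprD addNKr.
Qed.

(** The image of M -> coker(phi) is M modulo the pullback of M and A over B, so the projection of
    this pullback to [M] presents it. *)
Lemma heart_image (M : lmodType R) L (b : chmap (stalk M) L) : CC M -> heart CC L ->
  exists N (n : chmap N L) (b' : chmap (stalk M) N),
    [/\ heart CC N, homotopic (chcomp n b') b, stalk_injective CC n &
        forall M', CC M' -> forall c : chmap (stalk M') N,
          exists c0 : {linear M' -> M}, homotopic c (chcomp b' (stalk_lin c0))].
Proof.
move=> CM hL; have [A [B [phi [z [[fA fB] hA zinj _ zlift]]]]] := heart_resolution hL.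
pose b0 : {linear M -> B} := chcomp z b 0.
have hP : submodule (fun x : M * A => b0 x.1 = phi x.2).
  split=> [|x y Ex Ey|a x Ex]; first by rewrite !linear0.
    by rewrite -[LHS]/(b0 (x.1 + y.1)) -[RHS]/(phi (x.2 + y.2)) !linearD Ex Ey.
  rewrite -[LHS]/(b0 (a *: x.1)) -[RHS]/(phi (a *: x.2)) !linearZ.
  by congr (_ *: _).
pose psi : {linear subm hP -> M} := @lfst _ M A \o subm_incl hP.
pose snd : {linear subm hP -> A} := @lsnd _ M A \o subm_incl hP.
have sndE x : phi (snd x) = b0 (psi x) by exact/esym/(submP x).
have hPA : heartA (three psi).
  have fM := CC_fg CM; have fP := noeth hP (fg_pair fM fA).
  by apply: three_heartA => //; apply: noeth.
pose kap : chmap (three psi) (three phi) :=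
  @three_map _ _ _ phi (three psi) (b0 : {linear three psi 0 -> B}) snd sndE.
have [N [q [aq hN]]] := heartA_approximation hPA.
have [n nE] := zlift N (chcomp kap q) hN.1.
pose e := stalk_three psi (idfun : {linear M -> M}).
have [b' b'E] := approximation_lift e aq (stalk_Kminus hCC CM).
have zn M' (c : chmap (stalk M') N) :
    homotopic (chcomp z (chcomp n c)) (chcomp kap (chcomp q c)).
  apply: homotopic_trans (chcompA _ _ _) _.
  apply: homotopic_trans (chcompl c nE) _.
  exact: homotopic_sym (chcompA _ _ _).
exists N, n, b'; split => //.
- apply: zinj => //; apply: homotopic_trans (zn _ b') _.
  by apply: homotopic_trans (chcompr kap b'E) _; apply: stalk_ext.
- move=> M' CM' c c' H; apply: (approximation_inj aq (stalk_Kminus hCC CM')).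
  have /stalk_homotopicP[k kE] : homotopic (chcomp kap (chcomp q c)) (chcomp kap (chcomp q c')).
    apply: homotopic_trans (homotopic_sym (zn _ c)) _; apply: homotopic_trans (zn _ c').
    exact: chcompr.
  (* The homotopy [k] satisfies [b0 d = phi k], so the pair [(d, k)] lands in the pullback and is a
     homotopy in [three psi]. *)
  pose d : {linear M' -> M} := chcomp q c 0 \- chcomp q c' 0.
  have dk x : b0 ((lpair d k : {linear M' -> (M * A)%type}) x).1
      = phi ((lpair d k : {linear M' -> (M * A)%type}) x).2.
    by rewrite -[RHS]kE -[LHS]/(b0 (_ - _)) linearB.
  by apply/stalk_homotopicP; exists (subm_lift hP dk).
- move=> M' CM' c; exists (chcomp q c 0).
  apply: (approximation_inj aq (stalk_Kminus hCC CM')).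
  apply: homotopic_sym; apply: homotopic_trans (chcompA _ _ _) _.
  by apply: homotopic_trans (chcompl _ b'E) _; apply: stalk_ext.
Qed.

End HeartConstructions.

(** * Socles of Serre duals and simple quotients *)

Section StalkLinear.
Variable R : pzRingType.
Implicit Types (M N : lmodType R) (X : complex R).

Lemma stalk_stalk_homotopic M N (c c' : chmap (stalk M) (stalk N)) :
  homotopic c c' -> forall x : M, c 0 x = c' 0 x.
Proof. by move=> /stalk_homotopicP[k kE] x; apply/eqP; rewrite -subr_eq0 kE. Qed.

Lemma stalk_lin_repr M N (c : chmap (stalk M) (stalk N)) :
  homotopic c (stalk_lin (c 0 : {linear M -> N})).
Proof. exact: stalk_ext. Qed.

Lemma stalk_lin_chiso M (f g : {linear M -> M}) :
  cancel f g -> cancel g f -> chiso (stalk_lin f).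
Proof.
move=> fK gK; exists (stalk_lin g); split; apply: stalk_ext => x.
  exact: fK.
exact: gK.
Qed.

Lemma stalk_heartA M : finitely_generated M -> heartA (stalk M).
Proof.
move=> fM; split.
- by case=> [[|n]|n] //; apply: fg_rV0.
- by move=> i H; apply: stalk_zero; case: H; lia.
- move=> i x H _; exists 0; rewrite linear0; apply: stalk_zero; lia.
Qed.

End StalkLinear.

(** * Serre duality and the socle of S_C P_C *)

Section Serre.
Variables (k : comPzRingType) (R : algType k) (E : lmodType k).
Hypotheses (hR : artin_algebra R) (hE : injective_hull_residue E).
Variable CC : lmodType R -> Prop.
Hypotheses (hCC : karoubi_subcategory CC) (happ : approximating CC).
Variables (C : lmodType R) (hC : CC C).
Variables (SA SC : complex R) (theta : forall X : complex R, chmap X SA -> chmap (stalk C) X -> E).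
Hypothesis htheta : serre_isomorphism theta.
Variables (q : chmap SC SA) (hq : approximation CC q).

Let noeth := @artin_subfg k R hR.
Let fgC : finitely_generated C := CC_fg hCC hC.
Let hAC : heartA (stalk C) := stalk_heartA fgC.

Lemma serre_null X (s : chmap X SA) (f : chmap (stalk C) X) : heartA X ->
  homotopic s (chzero X SA) -> theta s f = 0.
Proof.
case: htheta => _ hom add _ _ hX s0; rewrite (proj1 (hom X hX _ _) s0).
apply: (addrI (theta (chzero X SA) f)); rewrite -add // addr0.
apply: (proj1 (hom X hX _ _)).
by apply: homotopic_ext => i x; rewrite /= addr0.
Qed.

(** A form on Hom(P_C, three phi) that is nonzero at [z p] is represented by a map to [SA]; composed
    with [z], it lifts through the approximation [q]. *)
Lemma serre_separates X (p : chmap (stalk C) X) : heart CC X ->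
  ~ homotopic p (chzero _ X) ->
  exists s : chmap X SC, ~ homotopic (chcomp s p) (chzero _ SC).
Proof.
move=> hX p0; have [A [B [phi [z [_ hA zinj _ _]]]]] := heart_resolution hCC happ noeth hX.
have [n [g gC]] := fgC; have [_ _ ark _] := hR.
(* Evaluation at generators of [C] realises chain maps inside a genuine [k]-module, where the
   null-homotopic ones take values in the submodule [N]. *)
pose ev (f : chmap (stalk C) (three phi)) : {ffun 'I_n -> kmod B} :=
  [ffun i => (f 0 : {linear C -> B}) (g i) : kmod B].
pose N (v : {ffun 'I_n -> kmod B}) :=
  exists h : {linear C -> A}, forall i, v i = phi (h (g i)).
have hN : submodule N.
  split.
  - by exists \0 => i; rewrite ffunE /= linear0.
  - move=> v w [h hE'] [h' hE'']; exists (h \+ h') => i.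
    by rewrite ffunE /= linearD hE' hE''.
  - move=> a v [h hE']; exists (kscale a h) => i.
    by rewrite ffunE hE' [RHS]linearZ.
have Nzp : ~ N (ev (chcomp z p)).
  move=> [h hE']; apply: p0; apply: zinj => //.
  apply: homotopic_trans (homotopic_sym (chcomp0 _ z)); apply/stalk_null.
  exists h => x; have [c ->] := gC x.
  rewrite [LHS](linear_sum (chcomp z p 0 : {linear C -> B})) [RHS](linear_sum (phi \o h)).
  apply: eq_bigr => i _; rewrite linearZ [RHS]linearZ; congr (_ *: _).
  by have := hE' i; rewrite ffunE.
have [form [formN formx]] := hull_cogenerator hE ark hN Nzp.
have [surj hom _ _ nat] := htheta.
have [_ /(_ (fun f => form (ev f)))[|s sE]] := surj (three phi) hA.
  split.
  - move=> f f' /stalk_homotopicP[h hE']; apply/eqP; rewrite -subr_eq0 -linearB.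
    apply/eqP/formN; exists h => i; rewrite !ffunE; exact: hE'.
  - by move=> f f'; rewrite -linearD; congr (form _); apply/ffunP => i; rewrite !ffunE.
  - by move=> c f; rewrite -linearZ; congr (form _); apply/ffunP => i; rewrite !ffunE.
have [s' s'E] := approximation_lift (chcomp s z) hq hX.1.1.
exists s' => s'p; apply: formx.
rewrite -(sE (chcomp z p)).
(* Naturality moves [z p] into the first argument, where the composite with [s] is null as soon as
   [s' p] is. *)
have -> : theta s (chcomp z p) = theta (chcomp s (chcomp z p)) (chid _).
  rewrite nat // !sE; congr (form _); apply/ffunP => i; rewrite !ffunE //.
apply: serre_null => //.
apply: homotopic_trans (chcompA _ _ _) _.
apply: homotopic_trans (chcompl p (homotopic_sym s'E)) _.
apply: homotopic_trans (homotopic_sym (chcompA _ _ _)) _.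
exact: chcomp_null_r.
Qed.

Hypothesis hind : indecomposable C.
Variable m : chmap (stalk C) (stalk C) -> Prop.
Hypothesis hm : end_maximal_ideal m.

Let mm (f : {linear C -> C}) := m (stalk_lin f).

Lemma stalk_end_lin_ideal : lin_ideal mm.
Proof.
have [[mh m0 mD ml mr] _ _] := hm; split.
- by move=> f g fg; apply: mh; apply: stalk_ext.
- by apply: mh m0; apply: stalk_ext.
- by move=> f g mf mg; apply: mh (mD _ _ mf mg); apply: stalk_ext.
- by move=> f g mf; apply: mh (ml _ (stalk_lin g) mf); apply: stalk_ext.
- by move=> f g mf; apply: mh (mr _ (stalk_lin g) mf); apply: stalk_ext.
Qed.

Lemma stalk_end_proper : ~ mm idfun.
Proof.
have [[mh _ _ _ _] m1 _] := hm; move=> H; apply: m1; apply: mh H.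
exact: stalk_ext.
Qed.

Lemma stalk_end_maximal (n : {linear C -> C} -> Prop) : lin_ideal n ->
  ~ n idfun -> (forall f, mm f -> n f) -> forall f, n f -> mm f.
Proof.
move=> [next n0 nD nl nr] n1 mn f nf; have [[mh _ _ _ _] _ mmax] := hm.
apply: (mmax (fun c => n (c 0))) => //.
- split=> [c c' cc' nc| |c c' nc nc'|c c' nc|c c' nc].
  + by apply: next nc; apply: stalk_stalk_homotopic.
  + exact: next n0.
  + by apply: next (nD _ _ nc nc').
  + by apply: next (nl _ (c' 0 : {linear C -> C}) nc).
  + by apply: next (nr _ (c' 0 : {linear C -> C}) nc).
- by move=> c mc; apply: mn; apply: mh mc; apply: stalk_lin_repr.
Qed.

Let mm_bij := maximal_ideal_bij hR fgC hind stalk_end_lin_ideal stalk_end_proper stalk_end_maximal.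

Lemma end_ideal_nilpotent f : m f ->
  exists n, forall x, lin_iter n (f 0 : {linear C -> C}) x = 0.
Proof.
move=> mf; apply: (maximal_ideal_nilpotent hR fgC hind stalk_end_lin_ideal
  stalk_end_proper stalk_end_maximal).
by have [[mh _ _ _ _] _ _] := hm; apply: mh mf; apply: stalk_lin_repr.
Qed.

(** The form on End(C) that Serre duality attaches to [q tau]; naturality makes composing [tau] with
    an endomorphism a translation of the form. *)
Definition serre_form (tau : chmap (stalk C) SC) (f : {linear C -> C}) : E :=
  theta (chcomp q tau) (stalk_lin f).

Lemma serre_form_ideal tau :
  (forall f, m f -> homotopic (chcomp tau f) (chzero (stalk C) SC)) ->
  ideal_form mm (serre_form tau).
Proof.
move=> taum; have [surj _ _ _ nat] := htheta.
have [/(_ (chcomp q tau))[hh hD hZ] _] := surj _ hAC.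
split.
- by move=> f g fg; apply: hh; apply: stalk_ext.
- by move=> f g; rewrite /serre_form -hD; apply: hh; apply: stalk_ext.
- by move=> c f; rewrite /serre_form -hZ; apply: hh; apply: stalk_ext.
- move=> f mf; rewrite /serre_form.
  have -> : theta (chcomp q tau) (stalk_lin f)
      = theta (chcomp (chcomp q tau) (stalk_lin f)) (chid _).
    by rewrite (nat _ _ hAC hAC (stalk_lin f)); apply: hh; apply: stalk_ext.
  apply: serre_null => //.
  apply: homotopic_trans (homotopic_sym (chcompA _ _ _)) _.
  by apply: chcomp_null_r; apply: taum.
Qed.

Lemma serre_form_inj (tau tau' : chmap (stalk C) SC) :
  (forall f, serre_form tau f = serre_form tau' f) -> homotopic tau tau'.
Proof.
move=> H; apply: (approximation_inj hq (stalk_Kminus hCC hC)).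
have [surj hom _ _ _] := htheta; apply/(hom _ hAC) => c.
have [/(_ (chcomp q tau))[hh _ _] _] := surj _ hAC.
have [/(_ (chcomp q tau'))[hh' _ _] _] := surj _ hAC.
by rewrite (hh _ _ (stalk_lin_repr c)) (hh' _ _ (stalk_lin_repr c)); apply: H.
Qed.

(** Both maps correspond to forms vanishing on [m], so the form of [tau'] is the translate of that
    of [tau] by some [u]. *)
Lemma socle_unique (tau tau' : chmap (stalk C) SC) :
  ~ homotopic tau (chzero (stalk C) SC) ->
  (forall f, m f -> homotopic (chcomp tau f) (chzero (stalk C) SC)) ->
  ~ homotopic tau' (chzero (stalk C) SC) ->
  (forall f, m f -> homotopic (chcomp tau' f) (chzero (stalk C) SC)) ->
  exists u, chiso u /\ homotopic tau' (chcomp tau u).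
Proof.
move=> tau0 taum tau'0 tau'm.
have [|u uE] := ideal_form_generates hR fgC hind stalk_end_lin_ideal stalk_end_proper
  stalk_end_maximal hE (serre_form_ideal taum) _ (serre_form_ideal tau'm).
  apply: contrapT => no; apply: tau0; apply: serre_form_inj => f.
  rewrite [RHS]serre_null //; first by apply: contrapT => nf; apply: no; exists f.
  exact: chcomp0.
have tau'u : homotopic tau' (chcomp tau (stalk_lin u)).
  apply: serre_form_inj => f; rewrite uE /serre_form.
  have [surj _ _ _ nat] := htheta.
  have [/(_ (chcomp q tau))[hh _ _] _] := surj _ hAC.
  have -> : theta (chcomp q tau) (stalk_lin (u \o f))
      = theta (chcomp (chcomp q tau) (stalk_lin u)) (stalk_lin f).
    by rewrite (nat _ _ hAC hAC (stalk_lin u)); apply: hh; apply: stalk_ext.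
  have [_ hom _ _ _] := htheta; apply: (proj1 (hom _ hAC _ _)).
  exact: homotopic_sym (chcompA _ _ _).
exists (stalk_lin u); split => //.
(* A non-invertible [u] lies in [m], which would make [tau u], hence [tau'], zero. *)
have [/lin_inverse[g [uK gK]]|nu] := EM (bijective u); first exact: stalk_lin_chiso uK gK.
case: tau'0; apply: homotopic_trans tau'u _; apply: taum.
exact/mm_bij.
Qed.

End Serre.

(** * Simple objects of H_C *)

Section Simple.
Variables (R : pzRingType) (CC : lmodType R -> Prop).
Hypotheses (hCC : karoubi_subcategory CC) (happ : approximating CC).
Hypothesis noeth : forall (M : lmodType R) (N : M -> Prop) (hN : submodule N),
  finitely_generated M -> finitely_generated (subm hN).
Implicit Types X Y L : complex R.

Lemma mono_of_stalks X Y (f : chmap X Y) : Tge0 CC X -> stalk_injective CC f ->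
  mono_in (heart CC) f.
Proof.
move=> gX finj Z g h [lZ gZ] fgh; apply: (homotopic_of_stalks hCC) => // M CM b.
apply: finj => //; apply: homotopic_trans (chcompA _ _ _) _.
exact: homotopic_trans (chcompl b fgh) (homotopic_sym (chcompA _ _ _)).
Qed.

Lemma simple_image L (M : lmodType R) (b : chmap (stalk M) L) :
  simple_in (heart CC) L -> CC M -> ~ homotopic b (chzero _ L) ->
  exists N (n : chmap N L) (b' : chmap (stalk M) N),
    [/\ heart CC N, chiso n, homotopic (chcomp n b') b &
        forall M', CC M' -> forall c : chmap (stalk M') N,
          exists c0 : {linear M' -> M}, homotopic c (chcomp b' (stalk_lin c0))].
Proof.
move=> [hL _ simp] CM b0.
have [N [n [b' [hN nb' ninj lift]]]] := heart_image hCC happ noeth b CM hL.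
exists N, n, b'; split => //.
case: (simp N n hN (mono_of_stalks hN.2 ninj)) => // N0; case: b0.
apply: homotopic_trans (homotopic_sym nb') _; apply: chcomp_null_r.
by apply: homotopic_trans (chcomp_null_l b' N0); apply: homotopic_ext.
Qed.

(** A nonzero [d] killed by [s] has image all of [L], so every stalk map to [L] factors through [d]
    and [s] would vanish. *)
Lemma simple_stalk_injective L Y (s : chmap L Y) :
  simple_in (heart CC) L -> Tge0 CC Y -> ~ homotopic s (chzero L Y) ->
  stalk_injective CC s.
Proof.
move=> sL gY s0 M CM b b' sbb'; apply/homotopic_sub0; set d := chsub b b'.
have sd : homotopic (chcomp s d) (chzero _ Y).
  apply: homotopic_trans (proj1 (homotopic_sub0 _ _) sbb').
  by apply: homotopic_ext => i x; rewrite /= linearB.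
apply: contrapT => d0.
have [N [n [d' [hN [n' [_ nn']] nd' lift]]]] := simple_image sL CM d0.
apply: s0; have sn : homotopic (chcomp s n) (chzero _ Y).
  apply: (null_of_stalks hCC hN.1 gY) => M' CM' c; have [c0 cE] := lift M' CM' c.
  apply: homotopic_trans (homotopic_sym (chcompA _ _ _)) _.
  apply: homotopic_trans (chcompr s (chcompr n cE)) _.
  apply: homotopic_trans (chcompr s (chcompA _ _ _)) _.
  apply: homotopic_trans (chcompr s (chcompl _ nd')) _.
  apply: homotopic_trans (chcompA _ _ _) _.
  exact: chcomp_null_l.
apply: homotopic_trans (chcomp_null_l n' sn).
apply: homotopic_trans (chcompA _ _ _).
by apply: homotopic_trans (chcompr s (homotopic_sym nn')); apply: homotopic_ext.
Qed.

Lemma epi_simple_neq0 P X L (p : chmap X L) : simple_in P L -> epi_in P p ->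
  ~ homotopic p (chzero X L).
Proof.
move=> [PL L0 _] pepi p0; apply: L0; exact: pepi.
Qed.

(** With [g] nilpotent this forces [p] to be null. *)
Lemma chcomp_absorb X (M : lmodType R) (p : chmap (stalk M) X) (g : {linear M -> M}) n :
  homotopic p (chcomp p (stalk_lin g)) ->
  homotopic p (chcomp p (stalk_lin (lin_iter n g))).
Proof.
move=> pg; elim: n => [|n IH]; first exact: stalk_ext.
apply: homotopic_trans IH _.
apply: homotopic_trans (chcompl _ pg) _; exact: stalk_ext.
Qed.

End Simple.

(** * The simple quotient of P_C as the image of tau *)

Theorem corollary4p2
  (k : comPzRingType) (R : algType k) (E : lmodType k)
  (hR : artin_algebra R) (hE : injective_hull_residue E)
  (CC : lmodType R -> Prop)
  (hCC : karoubi_subcategory CC) (happ : approximating CC)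
  (C : lmodType R) (hC : CC C) (hind : indecomposable C)
  (m : chmap (stalk C) (stalk C) -> Prop) (hm : end_maximal_ideal m)
  (SA SC : complex R) (hSA : serre_object E C SA)
  (q : chmap SC SA) (hq : approximation CC q)
  (tau : chmap (stalk C) SC)
  (htau : ~ homotopic tau (chzero (stalk C) SC))
  (htaum : forall f, m f -> homotopic (chcomp tau f) (chzero (stalk C) SC)) :
  (forall L I : complex R,
     simple_quotient CC C L -> image_in (heart CC) tau I -> isomorphic L I) /\
  (forall tau' : chmap (stalk C) SC,
     ~ homotopic tau' (chzero (stalk C) SC) ->
     (forall f, m f -> homotopic (chcomp tau' f) (chzero (stalk C) SC)) ->
     exists u : chmap (stalk C) (stalk C),
       chiso u /\ homotopic tau' (chcomp tau u)).
Proof.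
have [[hSA' _] [theta htheta]] := hSA.
have noeth := @artin_subfg k R hR.
have hSC : heart CC SC := approximation_heart hCC hSA' hq.
have uniq := socle_unique hR hE hCC hC htheta hq hind hm.
split; last by move=> tau' tau'0 tau'm; apply: uniq.
move=> L I [sL [p pepi]] [Q [q' [i [[hQ q'tau cokQ] [hI q'i kerI]]]]].
have hL : heart CC L by case: sL.
have p0 := epi_simple_neq0 sL pepi.
have [s sp0] := serre_separates hR hE hCC happ hC htheta hq hL p0.
have sinj : stalk_injective CC s.
  apply: (simple_stalk_injective hCC happ noeth sL hSC.2) => s0.
  by apply: sp0; apply: chcomp_null_l.
have pm f : m f -> homotopic (chcomp p f) (chzero _ L).
  move=> mf; apply: contrapT => pf0.
  (* If [p f] were nonzero, its image would be all of [L], so [p] would factor through it as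
     [p f c0]; but [f c0] lies in [m] and is nilpotent. *)
  have [N [n [b [hN [n' [n'n nn']] nb lift]]]] := simple_image hCC happ noeth sL hC pf0.
  have [c0 cE] := lift C hC (chcomp n' p); set g := chcomp f (stalk_lin c0).
  have [[_ _ _ _ mr] _ _] := hm.
  have [d g0] := end_ideal_nilpotent hR hCC hC hind hm (mr f (stalk_lin c0) mf).
  have pg : homotopic p (chcomp p (stalk_lin (g 0 : {linear C -> C}))).
    apply: (homotopic_trans (g := chcomp p g)); last first.
      exact: chcompr (stalk_lin_repr g).
    apply: homotopic_sym; apply: homotopic_trans (chcompA _ _ _) _.
    apply: homotopic_trans (chcompl _ (homotopic_sym nb)) _.
    apply: homotopic_trans (homotopic_sym (chcompA _ _ _)) _.
    apply: homotopic_trans (chcompr n (homotopic_sym cE)) _.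
    apply: homotopic_trans (chcompA _ _ _) _.
    by apply: homotopic_trans (chcompl p nn') _; apply: homotopic_ext.
  apply: p0; apply: homotopic_trans (chcomp_absorb d pg) _.
  by apply: chcomp_null_r; apply: stalk_ext => x; apply: g0.
have [|u [[u' [u'u uu']] tauE]] := uniq (chcomp s p) tau sp0 _ htau htaum.
  move=> f mf; apply: homotopic_trans (homotopic_sym (chcompA _ _ _)) _.
  by apply: chcomp_null_r; apply: pm.
(* As [p] is epi, it suffices that [q' s p] vanishes; up to an automorphism it is [q' tau]. *)
have q's : homotopic (chcomp q' s) (chzero L Q).
  apply: pepi => //; apply: homotopic_trans (homotopic_sym (ch0comp _ p)).
  apply: homotopic_trans (homotopic_sym (chcompA _ _ _)) _.
  have spE : homotopic (chcomp s p) (chcomp tau u').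
    apply: homotopic_sym; apply: homotopic_trans (chcompl u' tauE) _.
    apply: homotopic_trans (homotopic_sym (chcompA _ _ _)) _.
    by apply: homotopic_trans (chcompr _ uu') _; apply: homotopic_ext.
  apply: homotopic_trans (chcompr q' spE) _; apply: homotopic_trans (chcompA _ _ _) _.
  exact: chcomp_null_l.
have [v [iv _]] := kerI L s hL q's.
exists v; apply: (chiso_of_stalks hCC hL hI).
- move=> M CM b b' vb; apply: sinj => //.
  apply: homotopic_trans (chcompl b (homotopic_sym iv)) _.
  apply: homotopic_trans (homotopic_sym (chcompA _ _ _)) _.
  apply: homotopic_trans (chcompr i vb) _.
  by apply: homotopic_trans (chcompA _ _ _) (chcompl b' iv).
move=> M CM b.
(* [Q] is known only by its universal property; comparison with the constructed [G] shows that stalk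
   maps killed by [q'] factor through [tau]. *)
have [G [c [hG ctau clift]]] := heart_cokernel hCC happ noeth tau hC hSC.
have [w [wq' _]] := cokQ G c hG ctau.
have [|b1 b1E] := clift M CM (chcomp i b).
  apply: homotopic_trans (chcompl _ (homotopic_sym wq')) _.
  apply: homotopic_trans (homotopic_sym (chcompA _ _ _)) _; apply: chcomp_null_r.
  apply: homotopic_trans (chcompA _ _ _) _; exact: chcomp_null_l.
(* Indeed [i b = tau b1 = s p u b1 = i v p u b1], and the uniqueness clause of the kernel cancels
   [i]. *)
exists (chcomp p (chcomp u b1)).
have q'ib : homotopic (chcomp q' (chcomp i b)) (chzero _ Q).
  by apply: homotopic_trans (chcompA _ _ _) _; apply: chcomp_null_l.
have [x [_ xuniq]] := kerI (stalk M) (chcomp i b) (stalk_heart hCC CM) q'ib.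
apply: homotopic_trans (homotopic_sym (xuniq b (homotopic_refl _))).
apply: xuniq; apply: homotopic_trans b1E.
apply: homotopic_trans (chcompA _ _ _) _; apply: homotopic_trans (chcompl _ iv) _.
apply: homotopic_trans (chcompl _ (homotopic_sym tauE)).
exact: homotopic_ext.
Qed.
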